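(* Let $A_S$ be an irreducible Artin group of FC type with defining graph $\Gamma$. Suppose that $\Gamma$ is not a join and has at least two vertices. Then the complex of parabolic subgroups $\mathcal{CP}_{A_S}$ has infinite diameter.
   Context: Let $\Gamma$ be a finite simplicial graph with vertex set $S=\{s_1,\dots,s_n\}$, where each edge between $s_i$ and $s_j$ is labeled by an integer $m_{ij}=m_{ji}\ge 2$. If there is no edge between $s_i$ and $s_j$ (with $i\neq j$), write $m_{ij}=\infty$. The Artin group $A_S$ associated to $\Gamma$ (its defining graph) is the group with generating set $S$ and, for every edge between $s_i$ and $s_j$, the relation $\underbrace{s_is_js_i\cdots}_{m_{ij}\text{ terms}}=\underbrace{s_js_is_j\cdots}_{m_{ij}\text{ terms}}$ (no relation when $m_{ij}=\infty$). The Coxeter group $W_S$ is the quotient of $A_S$ obtained by adding the relations $s_i^2=1$ for all $i$. $A_S$ is of finite type if $W_S$ is finite. For $T\subseteq S$, $A_T$ denotes the subgroup of $A_S$ generated by $T$; it is naturally isomorphic to the Artin group associated to the full labeled subgraph of $\Gamma$ spanned by $T$. A parabolic subgroup is a conjugate $gA_Tg^{-1}$ with $g\in A_S$, $T\subseteq S$; it is finite type if $A_T$ is of finite type (i.e. the Coxeter group $W_T$ of the full subgraph spanned by $T$ is finite), and proper if it is not equal to $A_S$. The Artin group $A_T$, and any parabolic subgroup $gA_Tg^{-1}$, is irreducible if $T\neq\emptyset$ and $T$ cannot be partitioned into two nonempty subsets $T_1\sqcup T_2$ such that every element of $T_1$ commutes with every element of $T_2$ (i.e. all $m_{ij}=2$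 between $T_1$ and $T_2$). $A_S$ is of FC type if for every subset $T\subseteq S$ spanning a clique in $\Gamma$, $A_T$ is of finite type. The graph $\Gamma$ is a join if its vertex set can be partitioned into two nonempty subsets such that every vertex of the first is joined by an edge (with any label) to every vertex of the second. Two parabolic subgroups $P,Q$ of $A_S$ are adjacent if either (i) $P\subsetneq Q$ or $Q\subsetneq P$; or (ii) $P\cap Q=\{1\}$ and $pq=qp$ for all $p\in P$, $q\in Q$. The complex of parabolic subgroups $\mathcal{CP}_{A_S}$ is the flag simplicial complex whose vertices are the proper irreducible finite type parabolic subgroups of $A_S$ (in particular nontrivial), with an edge between two distinct vertices exactly when they are adjacent. Its diameter is the supremum of distances between vertices in the path metric of the 1-skeleton (each edge of length 1), where vertices in different connected components are at infinite distance; in particular, a disconnected complex has infinite diameter. *)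

(* Defs.v *)
From HB Require Import structures.
From mathcomp Require Import all_boot all_order all_algebra.
From mathcomp Require Import boolp classical_sets cardinality reals ereal.

Set Implicit Arguments.
Unset Strict Implicit.
Unset Printing Implicit Defensive.

Local Open Scope classical_set_scope.
Local Open Scope quotient_scope.

(* Groups given by generators and relations. The letter (x, false) stands for
   the generator x and (x, true) for its inverse; a relation R u v imposes
   u = v in the group. *)

Definition word (X : Type) := seq (X * bool).

Definition word_inv (X : Type) (u : word X) : word X :=
  rev [seq (l.1, ~~ l.2) | l <- u].

Inductive pres_eq (X : Type) (R : word X -> word X -> Prop) :
    word X -> word X -> Prop :=
| pres_eq_rel u v of R u v : pres_eq R u v
| pres_eq_cancel x b : pres_eq R [:: (x, b); (x, ~~ b)] [::]
| pres_eq_refl u : pres_eq R u u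
| pres_eq_sym u v of pres_eq R u v : pres_eq R v u
| pres_eq_trans v u w of pres_eq R u v & pres_eq R v w : pres_eq R u w
| pres_eq_cat u u' v v' of pres_eq R u u' & pres_eq R v v' :
    pres_eq R (u ++ v) (u' ++ v').

Section Presentation.
Variables (X : choiceType) (R : word X -> word X -> Prop).

Definition pres_eqb : rel (word X) := fun u v => `[< pres_eq R u v >].

Lemma pres_eqb_refl : reflexive pres_eqb.
Proof. by move=> u; apply/asboolP; exact: pres_eq_refl. Qed.

Lemma pres_eqb_sym : symmetric pres_eqb.
Proof. by move=> u v; apply/asboolP/asboolP; exact: pres_eq_sym. Qed.

Lemma pres_eqb_trans : transitive pres_eqb.
Proof.
by move=> v u w /asboolP uv /asboolP vw; apply/asboolP; apply: pres_eq_trans vw.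
Qed.

Canonical pres_equiv :=
  EquivRel pres_eqb pres_eqb_refl pres_eqb_sym pres_eqb_trans.

Definition presented := {eq_quot pres_equiv}.
HB.instance Definition _ := Choice.on presented.

Definition pres_word (u : word X) : presented := \pi_{eq_quot pres_equiv} u.
Definition pres_gen (x : X) : presented := pres_word [:: (x, false)].

Definition pres_one : presented := pres_word [::].
Definition pres_mul (a b : presented) : presented :=
  pres_word (repr (a : {eq_quot pres_equiv}) ++ repr (b : {eq_quot pres_equiv})).
Definition pres_inv (a : presented) : presented :=
  pres_word (word_inv (repr (a : {eq_quot pres_equiv}))).

Lemma pres_wordP u v : pres_word u = pres_word v <-> pres_eq R u v.
Proof.
split=> [/eqP|uv]; first by rewrite /pres_word piE => /asboolP.
by apply/eqP; rewrite /pres_word piE; apply/asboolP.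
Qed.

Lemma pres_word_surj a : exists u, a = pres_word u.
Proof. by exists (repr (a : {eq_quot pres_equiv})); rewrite /pres_word reprK. Qed.

Lemma pres_repr u : pres_eq R (repr (pres_word u : {eq_quot pres_equiv})) u.
Proof. by apply/pres_wordP; rewrite /pres_word reprK. Qed.

Lemma pres_eq_mulV u : pres_eq R (u ++ word_inv u) [::].
Proof.
elim: u => [|[x b] u IH]; first exact: pres_eq_refl.
have -> : ((x, b) :: u) ++ word_inv ((x, b) :: u) =
    [:: (x, b)] ++ ((u ++ word_inv u) ++ [:: (x, ~~ b)]).
  by rewrite /word_inv /= rev_cons -cats1 catA.
apply: (@pres_eq_trans _ _ ([:: (x, b)] ++ ([::] ++ [:: (x, ~~ b)]))).
  apply: pres_eq_cat (pres_eq_refl _ _) _.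
  exact: pres_eq_cat IH (pres_eq_refl _ _).
exact: pres_eq_cancel.
Qed.

Lemma word_invK : involutive (@word_inv X).
Proof.
move=> u; rewrite /word_inv map_rev revK -map_comp -[RHS]map_id.
by apply: eq_map => -[x b] /=; rewrite negbK.
Qed.

Lemma pres_eq_mulK u : pres_eq R (word_inv u ++ u) [::].
Proof. by rewrite -{2}[u]word_invK; exact: pres_eq_mulV. Qed.

Lemma pres_eq_inv u v : pres_eq R u v -> pres_eq R (word_inv u) (word_inv v).
Proof.
move=> uv; apply: (@pres_eq_trans _ _ (word_inv u ++ (v ++ word_inv v))).
  rewrite -{1}[word_inv u]cats0; apply: pres_eq_cat; first exact: pres_eq_refl.
  exact/pres_eq_sym/pres_eq_mulV.
rewrite catA -{2}[word_inv v]cat0s; apply: pres_eq_cat (pres_eq_refl _ _).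
apply: pres_eq_trans (pres_eq_mulK u).
by apply: pres_eq_cat (pres_eq_refl _ _) (pres_eq_sym uv).
Qed.

Lemma pres_mulE u v : pres_mul (pres_word u) (pres_word v) = pres_word (u ++ v).
Proof. by apply/pres_wordP/pres_eq_cat; exact: pres_repr. Qed.

Lemma pres_invE u : pres_inv (pres_word u) = pres_word (word_inv u).
Proof. exact/pres_wordP/pres_eq_inv/pres_repr. Qed.

Lemma pres_mulA : associative pres_mul.
Proof.
move=> a b c; have [u ->] := pres_word_surj a.
have [v ->] := pres_word_surj b; have [w ->] := pres_word_surj c.
by rewrite !pres_mulE catA.
Qed.

Lemma pres_mul1 : left_id pres_one pres_mul.
Proof. by move=> a; have [u ->] := pres_word_surj a; rewrite pres_mulE. Qed.

Lemma pres_mulr1 : right_id pres_one pres_mul.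
Proof. by move=> a; have [u ->] := pres_word_surj a; rewrite pres_mulE cats0. Qed.

Lemma pres_mulVl : left_inverse pres_one pres_inv pres_mul.
Proof.
move=> a; have [u ->] := pres_word_surj a; rewrite pres_invE pres_mulE.
exact/pres_wordP/pres_eq_mulK.
Qed.

Lemma pres_mulVr : right_inverse pres_one pres_inv pres_mul.
Proof.
move=> a; have [u ->] := pres_word_surj a; rewrite pres_invE pres_mulE.
exact/pres_wordP/pres_eq_mulV.
Qed.

HB.instance Definition _ := isGroup.Build presented
  pres_mulA pres_mul1 pres_mulr1 pres_mulVl pres_mulVr.

End Presentation.

Section Subgroups.
Variable gT : groupType.

Definition is_subgroup (H : set gT) : Prop :=
  H 1%g /\ forall x y, H x -> H y -> H (x / y)%g.

Definition generated (A : set gT) : set gT := smallest is_subgroup A.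

Definition conj_set (g : gT) (H : set gT) : set gT :=
  [set (g * x * g^-1)%g | x in H].

End Subgroups.

(* label s t = None encodes that there is no edge (m_st = oo when s <> t). *)
Record labeled_graph := LabeledGraph {
  vertex :> finType;
  label : vertex -> vertex -> option nat;
  label_sym : forall s t, label s t = label t s;
  label_irr : forall s, label s s = None;
  label_ge2 : forall s t m, label s t = Some m -> 2 <= m }.

Definition adjacent_vertices (G : labeled_graph) : rel G :=
  fun s t => isSome (label s t).

Definition is_clique (G : labeled_graph) (T : {set G}) : Prop :=
  forall s t, s \in T -> t \in T -> s != t -> adjacent_vertices s t.

Definition is_bipartition (V : finType) (T T1 T2 : {set V}) : Prop :=
  [/\ (T1 :|: T2)%SET = T, (T1 :&: T2)%SET = finset.set0,
      T1 != finset.set0 & T2 != finset.set0].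

Definition is_join (G : labeled_graph) : Prop :=
  exists T1 T2 : {set G}, is_bipartition [set: G]%SET T1 T2 /\
    forall s t, s \in T1 -> t \in T2 -> adjacent_vertices s t.

Section FullSubgraph.
Variables (G : labeled_graph) (T : {set G}).
Let V : finType := {s : G | s \in T}.
Let lab (s t : V) : option nat := label (val s) (val t).

Definition full_subgraph : labeled_graph :=
  @LabeledGraph V lab
    (fun s t => label_sym (val s) (val t))
    (fun s => label_irr (val s))
    (fun s t m => @label_ge2 G (val s) (val t) m).

End FullSubgraph.

Section ArtinGroup.
Variable G : labeled_graph.

(* s t s ... with m letters *)
Definition alternating (s t : G) (m : nat) : word G :=
  [seq (if odd i then t else s, false) | i <- iota 0 m].

Definition artin_rel (u v : word G) : Prop :=
  exists s t m,
    [/\ label s t = Some m, u = alternating s t m & v = alternating t s m].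

Definition coxeter_rel (u v : word G) : Prop :=
  artin_rel u v \/
  exists s : G, u = [:: (s, false); (s, false)] /\ v = [::].

Definition artin_group : groupType := presented artin_rel.
Definition coxeter_group : groupType := presented coxeter_rel.

Definition artin_gen (s : G) : artin_group := pres_gen artin_rel s.

Definition irreducible (T : {set G}) : Prop :=
  T != finset.set0 /\
  ~ exists T1 T2 : {set G}, is_bipartition T T1 T2 /\
      forall s t, s \in T1 -> t \in T2 -> label s t = Some 2.

Definition standard_parabolic (T : {set G}) : set artin_group :=
  generated [set artin_gen s | s in [set` T]].

End ArtinGroup.

Section Parabolics.
Variable G : labeled_graph.

Definition finite_type (T : {set G}) : Prop :=
  finite_set [set: coxeter_group (full_subgraph T)].

Definition FC_type : Prop := forall T : {set G}, is_clique T -> finite_type T.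

Definition irreducible_finite_type_parabolic (P : set (artin_group G)) : Prop :=
  exists (g : artin_group G) (T : {set G}),
    [/\ P = conj_set g (standard_parabolic T), irreducible T & finite_type T].

Definition adjacent_parabolics (P Q : set (artin_group G)) : Prop :=
  (P `<` Q \/ Q `<` P) \/
  (P `&` Q = [set 1%g] /\ forall p q, P p -> Q q -> (p * q)%g = (q * p)%g).

End Parabolics.

(* A simplicial complex is given by its set K of simplices, each simplex being
   the set of its vertices. *)
Definition flag_complex (T : Type) (V : set T) (E : T -> T -> Prop) :
    set (set T) :=
  [set K | [/\ finite_set K, K !=set0, K `<=` V &
               forall x y, K x -> K y -> x <> y -> E x y]].

Section Diameter.
Variables (T : Type) (K : set (set T)).

Definition complex_vertex : set T := [set x | K [set x]].
Definition complex_edge (x y : T) : Prop := x <> y /\ K [set x; y].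

Inductive edge_path : nat -> T -> T -> Prop :=
| edge_path0 x : edge_path 0 x x
| edge_pathS n x y z of complex_edge x y & edge_path n y z :
    edge_path n.+1 x z.

Variable R : realType.

(* ereal_inf of the empty set is +oo: vertices in different components. *)
Definition complex_dist (x y : T) : \bar R :=
  ereal_inf [set (n%:R%:E)%E | n in [set n | edge_path n x y]].

Definition diameter : \bar R :=
  ereal_sup [set complex_dist x y | x in complex_vertex & y in complex_vertex].

End Diameter.

Definition parabolic_complex (G : labeled_graph) :
    set (set (set (artin_group G))) :=
  flag_complex
    [set P | irreducible_finite_type_parabolic P /\ P <> [set: artin_group G]]
    (@adjacent_parabolics G).

Arguments parabolic_complex : clear implicits.

(* Main.v *)
(* Fix a vertex s which is not adjacent to every other vertex, say not to t.
   With B generated by S \ {s}, D by the star of s and C the intersection of B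
   and D inside A_S, the group A_S is the amalgam B *_C D, because every
   defining relation lies in B or in D; let T be its Bass-Serre tree.  A finite
   type subset is a clique, so a finite type parabolic fixes a vertex of T, and
   it contains a conjugate of a generator (a "reflection") if it is irreducible.
   If P is contained in Q, their fixed trees meet; they also meet when P and Q
   commute.  Hence an edge path of length n in the complex gives a geodesic of T
   which is a concatenation of at most 2n + 1 pieces, each fixed by a reflection.

   It remains to find an axis in T of which no reflection fixes a fundamental
   period.  In the geometric representation a reflection has a root v, and it
   can only fix the edge h C if h^-1 v has zero s- and t-coordinates.  Along the
   path with steps w t s (for vertices w other than s) this forces the
   translates of v by words in S \ {s} to be orthogonal to e_s and e_t, and as
   the Coxeter diagram is connected, a suitable finite word forces v to lie in
   the radical of the form, although v has norm 1. *)
Require Import Defs.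
From mathcomp Require Import all_boot all_order all_algebra.
From mathcomp Require Import boolp classical_sets cardinality reals ereal.
From mathcomp Require Import trigo ring lra.

Set Implicit Arguments.
Unset Strict Implicit.
Unset Printing Implicit Defensive.

Import Order.TTheory GRing.Theory Num.Theory.

(** * The geometric representation and the braid relations *)

Section GeometricRepresentation.
Local Open Scope ring_scope.
Variables (R : realType) (G : labeled_graph).
Implicit Types (v : G -> R) (s t u : G) (w : word G).

(** The Gram matrix of the Tits form; a missing edge counts as angle 0, hence the value [-1]. *)
Definition cosine s t : R :=
  if s == t then 1 else if label s t is Some m then - cos (pi / m%:R) else -1.

Definition simple_root s : G -> R := fun u => (u == s)%:R.
Definition pairing v s := \sum_u v u * cosine u s.
Definition srefl s v : G -> R := fun u => v u - 2 * pairing v s * simple_root s u.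
Definition coxform v v' := \sum_u v u * pairing v' u.

Lemma cosineC s t : cosine s t = cosine t s.
Proof. by rewrite /cosine eq_sym label_sym. Qed.

Lemma cosine_id s : cosine s s = 1.
Proof. by rewrite /cosine eqxx. Qed.

Lemma cosine_neq0 s t : label s t <> Some 2 -> cosine s t != 0.
Proof.
rewrite /cosine; case: (s =P t) => [_|_]; first by rewrite oner_neq0.
case E: (label s t) => [m|]; last by rewrite oppr_eq0 oner_neq0.
move=> m2; have m_ge3 : (2 < m)%N.
  rewrite ltn_neqAle (label_ge2 E) andbT eq_sym.
  by apply/eqP => m2'; apply: m2; rewrite m2'.
have m0 : 0 < m%:R :> R by rewrite ltr0n (leq_trans _ m_ge3).
rewrite oppr_eq0 gt_eqF// cos_gt0_pihalf//; apply/andP; split.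
  by rewrite (lt_le_trans (y := 0)) ?oppr_lt0 ?divr_ge0 ?divr_gt0 ?pi_gt0 ?pi_ge0// ltW.
rewrite ltr_pM2l ?pi_gt0// ltf_pV2 ?posrE ?ltr0n ?(ltnW (ltnW m_ge3))//.
by rewrite (ltr_nat R 2 m).
Qed.

Lemma pairing_lin a v v' s :
  pairing (fun u => a * v u + v' u) s = a * pairing v s + pairing v' s.
Proof.
by rewrite /pairing mulr_sumr -big_split; apply: eq_bigr => u _ /=; ring.
Qed.

Lemma pairing_simple_root s t : pairing (simple_root s) t = cosine s t.
Proof.
rewrite /pairing (bigD1 s)//= /simple_root eqxx mul1r big1 ?addr0// => u /negbTE ->.
by rewrite mul0r.
Qed.

Lemma pairing_srefl s v u : pairing (srefl s v) u = pairing v u - 2 * pairing v s * cosine s u.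
Proof.
have -> : srefl s v = (fun x => (- (2 * pairing v s)) * simple_root s x + v x).
  by apply/funext => x; rewrite /srefl; ring.
by rewrite pairing_lin pairing_simple_root; ring.
Qed.

Lemma sreflK s : involutive (srefl s).
Proof.
move=> v; apply/funext => u.
by rewrite {1}/srefl pairing_srefl cosine_id /srefl; ring.
Qed.

Lemma srefl_lin s a v v' :
  srefl s (fun u => a * v u + v' u) = (fun u => a * srefl s v u + srefl s v' u).
Proof. by apply/funext => u; rewrite /srefl pairing_lin; ring. Qed.

Lemma srefl_scale s a v :
  srefl s (fun u => a * v u) = (fun u => a * srefl s v u).
Proof.
have fa : pairing (fun u => a * v u) s = a * pairing v s.
  by rewrite /pairing mulr_sumr; apply: eq_bigr => u _; rewrite mulrA.
by apply/funext => u; rewrite /srefl fa; ring.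
Qed.

Lemma srefl_fix s v : pairing v s = 0 -> srefl s v = v.
Proof. by move=> v0; apply/funext => u; rewrite /srefl v0; ring. Qed.

Lemma srefl_neq s v u : u != s -> srefl s v u = v u.
Proof. by move=> /negbTE us; rewrite /srefl /simple_root us mulr0 subr0. Qed.

Lemma coxformC v v' : coxform v v' = coxform v' v.
Proof.
rewrite /coxform /pairing.
under eq_bigr do rewrite mulr_sumr.
rewrite exchange_big /=; apply: eq_bigr => u _; rewrite mulr_sumr.
by apply: eq_bigr => x _; rewrite cosineC; ring.
Qed.

Lemma coxform_simple_root s v : coxform (simple_root s) v = pairing v s.
Proof.
rewrite /coxform (bigD1 s)//= /simple_root eqxx mul1r big1 ?addr0// => u /negbTE ->.
by rewrite mul0r.
Qed.

Lemma coxform_lin a v v' v2 :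
  coxform (fun u => a * v u + v' u) v2 = a * coxform v v2 + coxform v' v2.
Proof.
by rewrite /coxform mulr_sumr -big_split; apply: eq_bigr => u _ /=; ring.
Qed.

Lemma coxform_srefl s v v' : coxform (srefl s v) (srefl s v') = coxform v v'.
Proof.
have E x : srefl s x = (fun u => (- (2 * pairing x s)) * simple_root s u + x u).
  by apply/funext => u; rewrite /srefl; ring.
rewrite {1}E coxform_lin coxform_simple_root pairing_srefl cosine_id coxformC E coxform_lin.
by rewrite coxform_simple_root coxformC; ring.
Qed.

(* Letters act by reflections, so the exponent of a letter is irrelevant. *)
Definition wact w v := foldr (fun l => srefl l.1) v w.

Lemma wact_cat w w' v : wact (w ++ w') v = wact w (wact w' v).
Proof. exact: foldr_cat. Qed.

Lemma wact_lin w a v v' :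
  wact w (fun u => a * v u + v' u) = (fun u => a * wact w v u + wact w v' u).
Proof. by elim: w => //= l w ->; exact: srefl_lin. Qed.

Lemma coxform_wact w v v' : coxform (wact w v) (wact w v') = coxform v v'.
Proof. by elim: w => //= l w <-; exact: coxform_srefl. Qed.

Lemma alternatingS s t m :
  Defs.alternating s t m.+1 = (s, false) :: Defs.alternating t s m.
Proof.
rewrite /Defs.alternating /= -[1%N]addn0 iotaDl -map_comp.
by congr cons; apply: eq_map => i /=; case: (odd i).
Qed.

(* With theta = pi / m, the vectors [dihedral_vec theta s t x] trace out an
   ellipse in the plane of e_s and e_t, on which the two reflections act, up to
   sign, as x |-> - x and x |-> - x - 2 theta. *)
Definition dihedral_vec (theta : R) s t (x : R) : G -> R :=
  fun u => sin (x + theta) * simple_root s u + sin x * simple_root t u.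

Section Dihedral.
Variables (s t : G) (m : nat).
Hypothesis st : label s t = Some m.
Let theta : R := pi / m%:R.
Let vec := dihedral_vec theta s t.

Let s_neq_t : s != t.
Proof. by apply/eqP => e; move: st; rewrite e label_irr. Qed.

Let m_gt1 : (1 < m)%N. Proof. exact: label_ge2 st. Qed.

Let cst : cosine s t = - cos theta.
Proof. by rewrite /cosine (negbTE s_neq_t) st. Qed.

Let m_neq0 : m%:R != 0 :> R.
Proof. by rewrite pnatr_eq0 -lt0n (ltn_trans _ m_gt1). Qed.

Let sin_theta_gt0 : 0 < sin theta.
Proof.
have m0 : 0 < m%:R :> R by rewrite ltr0n (ltn_trans _ m_gt1).
apply: sin_gt0_pi; rewrite divr_gt0 ?pi_gt0//=.
by rewrite ltr_pdivrMr// ltr_pMr ?pi_gt0// ltr1n.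
Qed.

Let pairing_vec x u :
  pairing (vec x) u = sin (x + theta) * cosine s u + sin x * cosine t u.
Proof.
have -> : vec x = (fun y => sin (x + theta) * simple_root s y +
    (fun z => sin x * simple_root t z + (fun=> 0) z) y).
  by apply/funext => y; rewrite /vec /dihedral_vec; ring.
rewrite !pairing_lin !pairing_simple_root; congr (_ + _).
by rewrite /pairing big1 ?addr0// => z _; rewrite mul0r.
Qed.

Lemma srefl_vec1 x : srefl s (vec x) = (fun u => - vec (- x) u).
Proof.
apply/funext => u; rewrite /srefl pairing_vec cosine_id cosineC cst.
rewrite /vec /dihedral_vec addrC [- x + _]addrC sinB sinD sinN; ring.
Qed.

Lemma srefl_vec2 x :
  srefl t (vec x) = (fun u => - vec (- x - 2 * theta) u).
Proof.
apply/funext => u; rewrite /srefl pairing_vec cosine_id cst.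
rewrite /vec /dihedral_vec.
have -> : - x - 2 * theta + theta = - (x + theta) by ring.
have -> : - x - 2 * theta = - ((x + theta) + theta) by ring.
have -> : sin (- ((x + theta) + theta)) = sin x - 2 * cos theta * sin (x + theta).
  rewrite sinN sinD sinD cosD.
  rewrite (_ : - _ = sin x * (cos theta ^+ 2 + sin theta ^+ 2) -
    2 * cos theta * (sin x * cos theta + cos x * sin theta)); last by ring.
  by rewrite cos2Dsin2 mulr1.
by rewrite sinN; ring.
Qed.

(** Two successive reflections shift the angle by [2 * theta] up to sign, which gives a closed form
    by induction on [k]; for odd [k] the angle is also reversed. *)
Let wact_alternating_vec k x :
  wact (Defs.alternating s t k) (vec x) = (fun u => (-1) ^+ k *
    vec (if odd k then - x + (k%:R - 1) * theta else x + k%:R * theta) u) /\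
  wact (Defs.alternating t s k) (vec x) = (fun u => (-1) ^+ k *
    vec (if odd k then - x - (k%:R + 1) * theta else x - k%:R * theta) u).
Proof.
elim: k => [|k [IH1 IH2]].
  by split; apply/funext => u; rewrite mul0r ?addr0 ?subr0 expr0 mul1r.
rewrite !alternatingS /= IH1 IH2 !srefl_scale.
split; apply/funext => u; rewrite ?srefl_vec1 ?srefl_vec2 exprSr.
  rewrite mulrN1 mulrN mulNr; congr (- (_ * vec _ _)).
  by case: (odd k) => /=; rewrite -[k.+1]addn1 natrD; ring.
rewrite mulrN1 mulrN mulNr; congr (- (_ * vec _ _)).
by case: (odd k) => /=; rewrite -[k.+1]addn1 natrD; ring.
Qed.

Let vec_periodic x : vec (x + 2 * pi) = vec x.
Proof.
apply/funext => u; rewrite /vec /dihedral_vec.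
rewrite (_ : x + 2 * pi + theta = x + theta + pi *+ 2); last by ring.
rewrite (_ : x + 2 * pi = x + pi *+ 2); last by ring.
by rewrite !sinD2pi.
Qed.

(** At [k = m] the two angles differ by [2 * m * theta = 2 * pi], so both words agree on the plane
    of the two simple roots. Vectors orthogonal to that plane are fixed by both words, and the two
    kinds span because the Gram determinant [sin theta ^+ 2] is nonzero. *)
Lemma wact_braid v :
  wact (Defs.alternating s t m) v = wact (Defs.alternating t s m) v.
Proof.
have mtheta : m%:R * theta = pi by rewrite /theta mulrC divfK.
have vecE x : wact (Defs.alternating s t m) (vec x) =
              wact (Defs.alternating t s m) (vec x).
  have [-> ->] := wact_alternating_vec m x; apply/funext => u.
  congr (_ * _); case: (odd m).
    rewrite -[in RHS]vec_periodic; congr (vec _ u).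
    by rewrite -mtheta; ring.
  by rewrite -[in RHS]vec_periodic; congr (vec _ u); rewrite -mtheta; ring.
set c := cos theta; set d := sin theta.
have d0 : d != 0 by rewrite gt_eqF.
have cd : c ^+ 2 = 1 - d ^+ 2 by rewrite -(cos2Dsin2 theta) addrK.
(* [a] and [b] solve the 2 by 2 Gram system, of determinant [1 - c ^+ 2 = d ^+ 2], so that [v0] is
   the part of [v] orthogonal to both roots. *)
pose a := (pairing v s + c * pairing v t) / d ^+ 2.
pose b := (pairing v t + c * pairing v s) / d ^+ 2.
pose v0 : G -> R := fun u => (- a) * simple_root s u + (- b * simple_root t u + v u).
have fv0 x : pairing v0 x = - a * cosine s x - b * cosine t x + pairing v x.
  by rewrite /v0 pairing_lin (pairing_lin (- b)) !pairing_simple_root; ring.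
have v0s : pairing v0 s = 0.
  rewrite fv0 cosine_id [cosine t s]cosineC cst /a /b -/c.
  rewrite [LHS](_ : _ = pairing v s * (d ^+ 2 - (1 - c ^+ 2)) / d ^+ 2).
    by rewrite cd subKr subrr mulr0 mul0r.
  by field.
have v0t : pairing v0 t = 0.
  rewrite fv0 cosine_id cst /a /b -/c.
  rewrite [LHS](_ : _ = pairing v t * (d ^+ 2 - (1 - c ^+ 2)) / d ^+ 2).
    by rewrite cd subKr subrr mulr0 mul0r.
  by field.
have v0E k : wact (Defs.alternating s t k) v0 = v0 /\
             wact (Defs.alternating t s k) v0 = v0.
  by elim: k => // k [I1 I2]; rewrite !alternatingS /= I1 I2 !srefl_fix.
(* [vec 0] is [d] times the root of [s], and [vec (- theta)] is [- d] times that of [t]. *)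
have -> : v = fun u => a / d * vec 0 u + (- b / d * vec (- theta) u + v0 u).
  apply/funext => u; rewrite /v0 /vec /dihedral_vec sin0 add0r addNr sin0 sinN.
  by rewrite -/d; field.
rewrite !(wact_lin _ (a / d) (vec 0)) !(wact_lin _ (- b / d) (vec (- theta)) v0).
by rewrite !vecE !(proj1 (v0E _)) !(proj2 (v0E _)).
Qed.

End Dihedral.
End GeometricRepresentation.

(** * Actions of groups given by presentations *)

Section PresentedGroups.
Local Open Scope group_scope.

(** The universal property of a presentation, for actions given letter by letter. The predicate
    [valid] allows letters to be invertible only on an invariant subset, as happens for normal
    forms. *)
Lemma foldr_pres_eq (X St : Type) (valid : St -> Prop) (f : X * bool -> St -> St)
    (rel : word X -> word X -> Prop) :
  (forall l st, valid st -> valid (f l st)) ->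
  (forall x b st, valid st -> f (x, b) (f (x, ~~ b) st) = st) ->
  (forall u v, rel u v -> forall st, valid st -> foldr f st u = foldr f st v) ->
  forall u v, pres_eq rel u v ->
  forall st, valid st -> foldr f st u = foldr f st v.
Proof.
move=> fV fK fR u v; elim=> {u v} //.
- by move=> u v _ IH st V; rewrite IH.
- by move=> v u w _ IH1 _ IH2 st V; rewrite IH1 ?IH2.
- move=> u u' v v' _ IH1 _ IH2 st V; rewrite !foldr_cat IH2 // IH1 //.
  by elim: v' {IH2} => //= l v' IH; exact: fV.
Qed.

Variables (X : choiceType) (rel : word X -> word X -> Prop).

Lemma pres_word_cat (u v : word X) :
  pres_word rel (u ++ v) = (pres_word rel u : presented rel) * pres_word rel v.
Proof. by rewrite -[RHS]/(pres_mul _ _) pres_mulE. Qed.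

Lemma pres_word_letter x b :
  pres_word rel [:: (x, b)] =
  if b then (pres_gen rel x : presented rel)^-1 else pres_gen rel x.
Proof. by case: b => //; rewrite -[RHS]/(pres_inv _) pres_invE. Qed.

Lemma pres_ind (P : presented rel -> Prop) :
  P 1 -> (forall x a, P a -> P (pres_gen rel x * a)) ->
  (forall x a, P a -> P ((pres_gen rel x)^-1 * a)) -> forall a, P a.
Proof.
move=> P1 Pgen Pinv a; have [u ->] := pres_word_surj a.
elim: u => [//|[x b] u IH]; rewrite -cat1s pres_word_cat pres_word_letter.
by case: b; [exact: Pinv | exact: Pgen].
Qed.

End PresentedGroups.

(** * Subgroups and standard parabolic subgroups *)

Section Subgroups.
Local Open Scope group_scope.
Variable gT : groupType.
Implicit Types H K : set gT.

Lemma is_subgroupV H x : is_subgroup H -> H x -> H x^-1.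
Proof. by move=> [H1 HB] Hx; rewrite -[x^-1]mul1g; exact: HB. Qed.

Lemma is_subgroupM H x y : is_subgroup H -> H x -> H y -> H (x * y).
Proof.
by move=> sH Hx Hy; rewrite -[y]invgK; apply: sH.2 => //; exact: is_subgroupV.
Qed.

Lemma is_subgroupMl H x y : is_subgroup H -> H x -> H (x * y) = H y.
Proof.
move=> sH Hx; apply/propext; split=> [Hxy|]; last exact: is_subgroupM.
by rewrite -(mulKg x y); apply: is_subgroupM => //; exact: is_subgroupV.
Qed.

Lemma is_subgroupMr H x y : is_subgroup H -> H y -> H (x * y) = H x.
Proof.
move=> sH Hy; apply/propext; split=> [Hxy|Hx]; last exact: is_subgroupM.
by rewrite -(mulgK y x); apply: sH.2.
Qed.

Lemma is_subgroupI H K : is_subgroup H -> is_subgroup K -> is_subgroup (H `&` K)%classic.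
Proof.
move=> sH sK; split; first by split; [exact: sH.1 | exact: sK.1].
by move=> x y [Hx Kx] [Hy Ky]; split; [exact: sH.2 | exact: sK.2].
Qed.

Lemma generated_subgroup H : is_subgroup (generated H).
Proof.
split=> [K [sK _]|x y Hx Hy K [sK HK]]; first exact: sK.1.
by apply: sK.2; [exact: Hx | exact: Hy].
Qed.

End Subgroups.

Section StandardParabolics.
Local Open Scope group_scope.
Variable G : labeled_graph.
Notation A := (artin_group G).

Lemma standard_parabolic_subgroup (T : {set G}) :
  is_subgroup (@standard_parabolic G T).
Proof. exact: generated_subgroup. Qed.

Lemma standard_parabolic_gen (T : {set G}) u :
  u \in T -> standard_parabolic T (artin_gen u).
Proof. by move=> uT K [_]; apply; exists u. Qed.

Lemma standard_parabolicP (T : {set G}) (a : A) :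
  standard_parabolic T a <->
  exists2 w : word G, all (fun l => l.1 \in T) w & a = pres_word _ w.
Proof.
split=> [|[w wT ->]].
  move=> /(_ [set a | exists2 w : word G,
    all (fun l => l.1 \in T) w & a = pres_word _ w]%classic); apply.
  split=> [|x [u uT <-]]; last first.
    by exists [:: (u, false)] => //=; rewrite andbT.
  split; first by exists [::].
  move=> x y [u uT ->] [v vT ->]; exists (u ++ word_inv v).
    by rewrite all_cat uT all_rev all_map.
  by rewrite pres_word_cat -pres_invE.
elim: w wT => [_|[x b] w IH /= /andP[xT /IH wT]].
  exact: (standard_parabolic_subgroup T).1.
rewrite -cat1s pres_word_cat pres_word_letter.
have sT := standard_parabolic_subgroup T; have gx := standard_parabolic_gen xT.
by apply: (is_subgroupM sT) => //; case: b => //; exact: (is_subgroupV sT).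
Qed.

Lemma standard_parabolic_sub (T T' : {set G}) (a : A) :
  T \subset T' -> standard_parabolic T a -> standard_parabolic T' a.
Proof.
move=> /fintype.subsetP TT' /standard_parabolicP[w wT ->]; apply/standard_parabolicP.
by exists w => //; apply: sub_all wT => l; exact: TT'.
Qed.

End StandardParabolics.

(** * Artin and Coxeter groups acting on the geometric representation *)

Section LinearAction.
Local Open Scope ring_scope.
Variables (R : realType) (G : labeled_graph).
Implicit Types (v : G -> R).

Lemma wact_coxeter_rel (u w : word G) :
  coxeter_rel u w -> forall v, wact u v = wact w v.
Proof.
case=> [[s [t [m [st -> ->]]]] v|[s [-> ->]] v]; first exact: wact_braid.
exact: sreflK.
Qed.

Lemma wact_pres_eq (rel : word G -> word G -> Prop) (u w : word G) :
  (forall u w, rel u w -> coxeter_rel u w) -> pres_eq rel u w ->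
  forall v, wact u v = wact w v.
Proof.
move=> relC uw v; apply: (foldr_pres_eq (valid := fun=> True)) uw v I => //.
- by move=> x b v _; exact: sreflK.
- by move=> u' w' /relC/wact_coxeter_rel + v _; apply.
Qed.

(** Computed on a chosen representative; [rel] stays arbitrary so that Artin and Coxeter groups
    share the definition. *)
Definition gact rel (a : presented rel) v := wact (repr a) v.

Section Quotient.
Variable rel : word G -> word G -> Prop.
Hypothesis relC : forall u w, rel u w -> coxeter_rel u w.
Implicit Types a b : presented rel.

Lemma gact_word (u : word G) v : gact (pres_word rel u) v = wact u v.
Proof. by apply: (wact_pres_eq relC); exact: pres_repr. Qed.

Lemma gact_mul a b v : gact (a * b)%g v = gact a (gact b v).
Proof.
have [u ->] := pres_word_surj a; have [w ->] := pres_word_surj b.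
by rewrite -pres_word_cat !gact_word wact_cat.
Qed.

Lemma gact1 v : gact (1%g : presented rel) v = v.
Proof. exact: (gact_word [::]). Qed.

Lemma gact_gen s v : gact (pres_gen rel s) v = srefl s v.
Proof. exact: gact_word. Qed.

Lemma gactK a v : gact a^-1%g (gact a v) = v.
Proof. by rewrite -gact_mul mulVg gact1. Qed.

Lemma gactVK a v : gact a (gact a^-1%g v) = v.
Proof. by rewrite -gact_mul mulgV gact1. Qed.

Lemma gact_genV s v : gact (pres_gen rel s)^-1%g v = srefl s v.
Proof. by rewrite -{1}[v](sreflK s) -(gact_gen s (srefl s v)) gactK. Qed.

Lemma coxform_gact a v v' : coxform (gact a v) (gact a v') = coxform v v'.
Proof. exact: coxform_wact. Qed.

Lemma gact_conj a s v :
  gact (a * pres_gen rel s * a^-1)%g v = 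
  (fun u => v u - 2 * coxform v (gact a (simple_root R s)) * gact a (simple_root R s) u).
Proof.
rewrite !gact_mul gact_gen -{2 3}[v](gactVK a) coxform_gact.
rewrite [coxform _ (simple_root R s)]coxformC coxform_simple_root.
set x := gact a^-1%g v; rewrite (_ : srefl s x =
  fun u => (- (2 * pairing x s)) * simple_root R s u + x u); last first.
  by apply/funext => u; rewrite /srefl; ring.
by rewrite /gact wact_lin; apply/funext => u; ring.
Qed.

End Quotient.

Lemma artin_coxeter (u w : word G) : artin_rel u w -> coxeter_rel u w.
Proof. by left. Qed.

(** A simple reflection changes only its own coordinate. This is the test used later to show that
    elements lie outside a standard parabolic subgroup. *)
Lemma gact_parabolic (T : {set G}) (a : artin_group G) v u :
  standard_parabolic T a -> u \notin T -> gact a v u = v u.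
Proof.
move=> /standard_parabolicP[w wT ->] uT; rewrite (gact_word artin_coxeter).
elim: w wT => //= l w IH /andP[lT /IH <-]; apply: srefl_neq.
by apply: contraNneq uT => ->.
Qed.

Lemma gen_notin_parabolic (T : {set G}) s :
  standard_parabolic T (artin_gen s) -> s \in T.
Proof.
move=> sT; apply/negP => /negP/(gact_parabolic (simple_root R s) sT).
rewrite (gact_gen artin_coxeter) /srefl pairing_simple_root cosine_id /simple_root eqxx /=.
by lra.
Qed.

End LinearAction.

(** * Finite type subsets are cliques *)

Section FiniteType.
Variables (R : realType) (G : labeled_graph).

(** The form is degenerate on the plane of the two roots and [x] acts there unipotently, so its
    powers send the root of [s] to pairwise distinct vectors. *)
Lemma coxeter_infinite (s t : G) : s != t -> label s t = None ->
  ~ finite_set [set: coxeter_group G].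
Proof.
move=> st lst fin.
pose x : coxeter_group G := (pres_gen _ s * pres_gen _ t)%g.
have xE n : gact (x ^+ n)%g (simple_root R s) =
    (fun u => (2 * n%:R + 1) * simple_root R s u + (2 * n%:R) * simple_root R t u)%R.
  have id_rel : forall u w : word G, coxeter_rel u w -> coxeter_rel u w by [].
  elim: n => [|n IH].
    by rewrite expg0 gact1//; apply/funext => u; rewrite /= !mulr0; ring.
  rewrite expgS !gact_mul// IH !gact_gen//.
  have cst : cosine R s t = (-1)%R by rewrite /cosine (negbTE st) lst.
  have fE a b u : pairing (fun y => a * simple_root R s y + b * simple_root R t y)%R u =
      (a * cosine R s u + b * cosine R t u)%R.
    rewrite pairing_lin pairing_simple_root -[(fun y => b * simple_root R t y)%R]/(fun y => _).
    rewrite (_ : (fun y => _) = (fun y => b * simple_root R t y + (fun=> 0) y)%R); last first.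
      by apply/funext => y; rewrite addr0.
    rewrite pairing_lin pairing_simple_root; congr (_ + _)%R.
    by rewrite /pairing big1 ?addr0// => z _; rewrite mul0r.
  rewrite {2}/srefl fE cst cosine_id.
  rewrite (_ : (fun u => _) = (fun u => (2 * n%:R + 1) * simple_root R s u +
     (2 * n.+1%:R) * simple_root R t u)%R); last first.
    by apply/funext => u; rewrite -[n.+1]addn1 natrD; ring.
  rewrite /srefl fE cosineC cst cosine_id.
  by apply/funext => u; rewrite -[n.+1]addn1 natrD; ring.
have inj : injective (fun n => x ^+ n)%g.
  move=> m n e; have := congr1 (fun y => gact y (simple_root R s) t) e.
  rewrite !xE /simple_root eqxx [t == s]eq_sym (negbTE st) /= => /eqP.
  rewrite !mulr0 !mulr1 !add0r => /eqP h.
  apply/eqP; rewrite -(eqr_nat R); apply/eqP; move: h; lra.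
apply: infinite_nat; have := finite_preimage (f := fun n => x ^+ n)%g _ fin.
by rewrite preimage_setT; apply => m n _ _; exact: inj.
Qed.

End FiniteType.

Section FiniteTypeClique.
Variables (R : realType) (G : labeled_graph).

Lemma finite_type_clique (T : {set G}) : finite_type T -> is_clique T.
Proof.
move=> fT s t sT tT st; rewrite /adjacent_vertices; case E: (label s t) => //.
case: (@coxeter_infinite R (full_subgraph T) (exist _ s sT) (exist _ t tT) st E fT).
Qed.

Lemma finite_type1 (t : G) : finite_type [set t].
Proof.
pose K := full_subgraph [set t]; rewrite /finite_type.
have tT : t \in [set t] by rewrite inE.
pose x : coxeter_group K := pres_gen _ (exist _ t tT : K).
have xx : (x * x = 1)%g.
  rewrite /x -pres_word_cat; apply/pres_wordP/pres_eq_rel; right.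
  by exists (exist _ t tT).
have xV : (x^-1 = x)%g by rewrite -[LHS]mulg1 -xx mulKg.
have genE (y : K) : pres_gen _ y = x.
  rewrite /x; congr pres_gen; apply/val_inj => /=.
  by case: y => y /= yT; move: (yT); rewrite inE => /eqP.
apply: (@sub_finite_set _ _ [set 1%g; x]); last exact: finite_set2.
move=> a _; elim/pres_ind: a => [|y a IH|y a IH]; first by left.
  by rewrite genE; case: IH => ->; [right; rewrite mulg1 | left].
by rewrite genE xV; case: IH => ->; [right; rewrite mulg1 | left].
Qed.

End FiniteTypeClique.

(** * Normal forms in an amalgam of two subgroups *)

Section Amalgam.
Local Open Scope group_scope.
Variables (gT : groupType) (H : bool -> set gT).
Hypothesis sH : forall e, is_subgroup (H e).
Implicit Types (e : bool) (x y t : gT) (l : seq gT).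

Definition amalgamated : set gT := (H true `&` H false)%classic.
Local Notation C := amalgamated.

Lemma amalgamated_subgroup : is_subgroup C.
Proof. exact: is_subgroupI. Qed.

Lemma amalgamatedP e x : C x <-> H e x /\ H (~~ e) x.
Proof. by case: e; split=> -[]. Qed.

Let sC := amalgamated_subgroup.

Let C_H e x : C x -> H e x. Proof. by case/(amalgamatedP e). Qed.

Fixpoint alternate e l : Prop :=
  if l is x :: l' then [/\ H e x, ~ C x & alternate (~~ e) l'] else True.

(* A canonical representative of the right coset C x. *)
Let tau x : gT := xget 1 [set y | C (y / x)]%classic.

Let tauP x : C (tau x / x).
Proof.
rewrite /tau; case: xgetP => [y _ //|/(_ x)].
by rewrite /= mulgV; case; exact: sC.1.
Qed.

Let tauMl c x : C c -> tau (c * x) = tau x.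
Proof.
move=> Cc; congr (xget 1 _); apply/predeqP => y /=.
by rewrite invgM mulgA is_subgroupMr //; exact: is_subgroupV.
Qed.

Let tauK x : tau (tau x) = tau x.
Proof. by rewrite -[X in tau X](mulgVK x) tauMl. Qed.

Let tau_C x : C (tau x) = C x.
Proof. by rewrite -{1}[tau x](mulgVK x) is_subgroupMl. Qed.

Let tau_H e x : H e (tau x) = H e x.
Proof. by rewrite -{1}[tau x](mulgVK x) is_subgroupMl //; exact: C_H. Qed.

Let tau_C' x : C (x / tau x).
Proof. by rewrite -invgF; exact: is_subgroupV. Qed.

(* A pair (c, [:: t1; ..; tn]) stands for the product c * t1 * .. * tn, where c
   is in C and the ti are representatives of nontrivial right cosets of C,
   alternately in H true and in H false. *)
Definition state := (gT * seq gT)%type.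

Fixpoint normal e l : Prop :=
  if l is t :: l' then [/\ H e t, ~ C t, tau t = t & normal (~~ e) l'] else True.

Definition valid (st : state) := C st.1 /\ exists e, normal e st.2.

(** Van der Waerden's trick: [pop e] merges the first representative into the head if it lies in
    [H e], and [push] splits it off again. They are mutually inverse between valid states and pairs
    of a head in [H e] and a tail starting on the other side, so [H e] acts by multiplying the
    merged head. *)
Definition pop e (st : state) : state :=
  if st.2 is t :: l then if `[< H e t >] then (st.1 * t, l) else st else st.

Definition push (st : state) : state :=
  if `[< C st.1 >] then st else (st.1 / tau st.1, tau st.1 :: st.2).

Definition amalgam_act e x st : state := let st' := pop e st in push (x * st'.1, st'.2).

Let pop_valid e st : valid st -> H e (pop e st).1 /\ normal (~~ e) (pop e st).2.
Proof.
case: st => c [|t l] [/= Cc [f]]; first by move=> _; split => //; exact: C_H.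
move=> [ft Ct tt nl]; rewrite /pop /=; case: asboolP => [et|et] /=.
  split; first by apply: is_subgroupM => //; exact: C_H.
  by have [<-//|ef] := eqVneq f e; case: Ct; apply/(amalgamatedP e); split=> //;
    move: ef ft; case: (e) (f) => -[].
split; first exact: C_H.
by have ef : f = ~~ e by [move: et ft; case: (e) (f) => -[]]; rewrite -ef.
Qed.

Let push_valid e y l : H e y -> normal (~~ e) l -> valid (push (y, l)).
Proof.
move=> Hy nl; rewrite /push /=; case: asboolP => Cy; first by split => //; exists (~~ e).
split; first exact: tau_C'.
by exists e; split=> //; [rewrite tau_H | rewrite tau_C].
Qed.

Let pushK e y l : H e y -> normal (~~ e) l -> pop e (push (y, l)) = (y, l).
Proof.
move=> Hy nl; rewrite /push /=; case: asboolP => Cy; last first.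
  by rewrite /pop /=; case: asboolP => [_|[]]; [rewrite mulgVK | rewrite tau_H].
rewrite /pop; case: l nl => //= t l [Ht Ct _ _].
by case: asboolP => // et; case: Ct; apply/(amalgamatedP e).
Qed.

Let popK e st : valid st -> push (pop e st) = st.
Proof.
case: st => c [|t l] [/= Cc [f nl]]; first by rewrite /pop /push /= asboolT.
rewrite /pop /=; case: asboolP => et; last by rewrite /push /= asboolT.
case: nl => _ Ct tt _; rewrite /push /= asboolF ?tauMl ?tt ?mulgK //.
by rewrite is_subgroupMl.
Qed.

Lemma amalgam_act_valid e x st : H e x -> valid st -> valid (amalgam_act e x st).
Proof.
move=> Hx /(pop_valid e)[Hp np].
by apply: (push_valid (e := e)) => //; exact: is_subgroupM.
Qed.

Lemma amalgam_actM e x y st : H e x -> H e y -> valid st ->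
  amalgam_act e x (amalgam_act e y st) = amalgam_act e (x * y) st.
Proof.
move=> Hx Hy /(pop_valid e)[Hp np]; rewrite /amalgam_act pushK ?mulgA //.
exact: is_subgroupM.
Qed.

Lemma amalgam_act1 e st : valid st -> amalgam_act e 1 st = st.
Proof. by move=> V; rewrite /amalgam_act mul1g -surjective_pairing popK. Qed.

(** On [C] the result does not depend on the side [e], which makes the two actions compatible. *)
Lemma amalgam_actC e x st : C x -> valid st ->
  amalgam_act e x st = (x * st.1, st.2).
Proof.
case: st => c l Cx [/= Cc nl]; rewrite /amalgam_act /=.
have V : valid (x * c, l) by split => //; exact: is_subgroupM.
rewrite -[RHS](popK e V) /pop /=; case: l {V nl} => //= t l.
by case: asboolP => //= _; rewrite mulgA.
Qed.

(** Stands for the universal property of the amalgam: the actions of the two subgroups extend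
    jointly to the whole group. *)
Hypothesis act_extends : exists ev : gT -> state -> state,
  (forall st, valid st -> ev 1 st = st) /\
  (forall e x g st, H e x -> valid st -> ev (x * g) st = amalgam_act e x (ev g st)).

(** Applied to the trivial normal form, an alternating product produces a tail as long as itself,
    whereas an element of [C] leaves the tail empty. *)
Lemma alternate_notin_amalgamated e x l :
  alternate e (x :: l) -> ~ C (\prod_(y <- x :: l) y).
Proof.
have [ev [ev1 evM]] := act_extends.
have V0 : valid (1, [::]) by split; [exact: sC.1 | exists true].
suff key l' f : alternate f l' -> let st := ev (\prod_(y <- l') y) (1, [::]) in
    [/\ valid st, normal f st.2 & size st.2 = size l'].
  move=> /key /= [_ _ sz] Cp; have Hp := C_H true Cp.
  by move: sz; rewrite -[X in ev X]mulg1 (evM true) // ev1 // amalgam_actC.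
elim: l' f => [|y l' IH] f; first by rewrite big_nil /= ev1.
move=> [Hy Cy /IH]; rewrite big_cons (evM f) //.
move: (ev _ _) => [c m] /= [V nm sz].
(* The tail starts on the side opposite to [f], so nothing is merged and [push] adds exactly one
   representative. *)
have popE : pop f (c, m) = (c, m).
  case: m {V sz} nm => //= t m [Ht Ct _ _]; rewrite /pop /=.
  by case: asboolP => // ft; case: Ct; apply/(amalgamatedP f).
split; first exact: amalgam_act_valid.
  rewrite /amalgam_act popE /push /= asboolF ?is_subgroupMr //; last exact: V.1.
  have Hyc : H f (y * c) by apply: is_subgroupM => //; apply: C_H; exact: V.1.
  by split=> //; [rewrite tau_H | rewrite tau_C is_subgroupMr //; exact: V.1].
by rewrite /amalgam_act popE /push /= asboolF ?is_subgroupMr //= ?sz //; exact: V.1.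
Qed.

End Amalgam.

(** * The Artin group as an amalgam at a vertex *)

Section ArtinAmalgam.
Local Open Scope group_scope.
Variables (G : labeled_graph) (s : G).
Implicit Types (u v : word G) (e : bool).

Definition star : {set G} := [set u | (u == s) || adjacent_vertices s u].

Definition side_vertices e : {set G} := if e then ~: [set s] else star.

Definition side e : set (artin_group G) := standard_parabolic (side_vertices e).

Lemma side_subgroup e : is_subgroup (side e).
Proof. exact: standard_parabolic_subgroup. Qed.

Let sS := side_subgroup.

Let letter (l : G * bool) (st : state (artin_group G)) :=
  amalgam_act side (l.1 != s) (pres_word _ [:: l]) st.

Let side_letter e (l : G * bool) : l.1 \in side_vertices e ->
  side e (pres_word _ [:: l]).
Proof.
by move=> le; apply/standard_parabolicP; exists [:: l] => //=; rewrite le.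
Qed.

Let side_letter_side (l : G * bool) : side (l.1 != s) (pres_word _ [:: l]).
Proof.
by apply: side_letter; case: eqP => [->|/eqP ls]; rewrite !inE ?eqxx.
Qed.

(** A letter that [letter] sends through the other side lies in [C], where both actions agree. *)
Let letter_word e u st : valid side st -> all (fun l => l.1 \in side_vertices e) u ->
  foldr letter st u = amalgam_act side e (pres_word _ u) st.
Proof.
move=> V; elim: u => [_|l u IH /= /andP[le ue]].
  by rewrite -[RHS]/(amalgam_act side e 1 st) amalgam_act1.
have Hu : side e (pres_word _ u) by apply/standard_parabolicP; exists u.
have Hl := side_letter le.
rewrite IH // -[l :: u]cat1s pres_word_cat -amalgam_actM // /letter.
have V' : valid side (amalgam_act side e (pres_word _ u) st).
  exact: amalgam_act_valid.
have [<-//|els] := eqVneq e (l.1 != s).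
have Cl : amalgamated side (pres_word _ [:: l]).
  apply/(amalgamatedP _ e); split=> //.
  have -> : ~~ e = (l.1 != s) by move: els; case: (l.1 != s); case: (e).
  exact: (@side_letter_side l).
by rewrite !(amalgam_actC sS _ Cl V').
Qed.

Lemma mem_alternating (a b : G) m l : l \in Defs.alternating a b m -> l.1 \in [:: a; b].
Proof.
by case/mapP => i _ ->; rewrite !inE /=; case: (odd i); rewrite eqxx ?orbT.
Qed.

(** If [s] occurs in a braid relation, both generators lie in its star; otherwise both differ from
    [s]. Either way the two words stay on one side and act as the same group element. *)
Let letter_rel u v : artin_rel u v ->
  forall st, valid side st -> foldr letter st u = foldr letter st v.
Proof.
move=> uv st V; have uvE : pres_word (@artin_rel G) u = pres_word (@artin_rel G) v.
  exact/pres_wordP/pres_eq_rel.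
case: uv uvE => [a [b [m [ab -> ->]]]] uvE.
pose e := (a != s) && (b != s).
have abe x : x \in [:: a; b] -> x \in side_vertices e.
  rewrite !inE /e /side_vertices; case: (a =P s) => [as_|/eqP as_] /=.
    by rewrite inE -as_ /adjacent_vertices => /orP[/eqP->|/eqP->]; rewrite ?eqxx ?ab ?orbT.
  case: (b =P s) => [bs|/eqP bs] /=.
    rewrite inE -bs /adjacent_vertices => /orP[/eqP->|/eqP->]; rewrite ?eqxx //.
    by rewrite label_sym ab orbT.
  by rewrite !inE => /orP[/eqP->|/eqP->].
have abw a' b' : a' \in [:: a; b] -> b' \in [:: a; b] ->
    all (fun l => l.1 \in side_vertices e) (Defs.alternating a' b' m).
  move=> a'P b'P; apply/allP => l /mem_alternating l'; apply: abe.
  by move: l'; rewrite inE => /orP[/eqP->//|]; rewrite inE => /eqP->.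
rewrite !(letter_word (e := e)) ?uvE //; apply: abw; rewrite !inE eqxx ?orbT //.
Qed.

Lemma artin_act_extends :
  exists ev : artin_group G -> state (artin_group G) -> state (artin_group G),
  (forall st, valid side st -> ev 1 st = st) /\
  (forall e x g st, side e x -> valid side st ->
     ev (x * g) st = amalgam_act side e x (ev g st)).
Proof.
have letterV l st : valid side st -> valid side (letter l st).
  by move=> V; apply: amalgam_act_valid => //; exact: (@side_letter_side l).
have foldV u st : valid side st -> valid side (foldr letter st u).
  by move=> V; elim: u => //= l u; exact: letterV.
have letterK x b st : valid side st -> letter (x, b) (letter (x, ~~ b) st) = st.
  move=> V; rewrite /letter /= amalgam_actM //;
    [|exact: (@side_letter_side (x, b))|exact: (@side_letter_side (x, ~~ b))].
  rewrite -pres_word_cat (_ : pres_word _ _ = 1) ?amalgam_act1 //.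
  exact/pres_wordP/pres_eq_cancel.
have evE u st : valid side st ->
    foldr letter st (repr (pres_word (@artin_rel G) u)) = foldr letter st u.
  by move=> V; exact: (foldr_pres_eq letterV letterK letter_rel (pres_repr _ u)) V.
exists (fun g st => foldr letter st (repr g)).
split=> [st V|e x g st /standard_parabolicP[u ue ->] V]; first exact: (evE [::]).
have [w ->] := pres_word_surj g; rewrite -pres_word_cat !evE // foldr_cat.
by rewrite (letter_word (e := e)) //; exact: foldV.
Qed.

End ArtinAmalgam.

(** * Reduced paths and group actions on trees *)

Section ReducedPaths.
Variables (X : Type) (adj : X -> X -> Prop).
Hypothesis adj_sym : forall x y, adj x y -> adj y x.
Implicit Types (x y z : X) (p q l m : seq X).

Fixpoint reduced l : Prop :=
  if l is x :: l' then
    if l' is y :: l'' then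
      [/\ adj x y, (if l'' is z :: _ then x <> z else True) & reduced l']
    else True
  else True.

(** Being reduced only constrains three consecutive vertices, so an overlap of two is enough for
    gluing. *)
Lemma reduced_cat2 l a b m :
  reduced (l ++ [:: a, b & m]) = (reduced (l ++ [:: a; b]) /\ reduced [:: a, b & m]).
Proof.
elim: l => [|x [|y l] IH].
- by apply/propext; split=> [r|[]//]; split=> //; case: r.
- by apply/propext; split=> [[xa xb rm]|[[xa xb _] rm]]; split=> //; split=> //; case: rm.
have E k : reduced ((x :: y :: l) ++ a :: b :: k) =
    [/\ adj x y, (if l is z :: _ then x <> z else x <> a)
     & reduced ((y :: l) ++ a :: b :: k)].
  by case: (l).
by rewrite !E IH; apply/propext; split=> [[? ? []]|[[? ? ?] ?]].
Qed.

Lemma reduced_rev l : reduced l -> reduced (rev l).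
Proof.
elim: l => [|x [|y [|z l]] IH] //.
  by move=> [xy _ _]; split=> //; exact: adj_sym.
move=> [xy xz /[dup] r /IH]; rewrite !rev_cons -!cats1 -!catA /= => r'.
rewrite reduced_cat2; split=> //; split; [|by move/esym| split => //]; last exact: adj_sym.
by case: r => yz _ _; exact: adj_sym.
Qed.

Lemma reduced_behead x l : reduced (x :: l) -> reduced l.
Proof. by case: l => // y l []. Qed.

Lemma reduced_catl l m : reduced (l ++ m) -> reduced l.
Proof.
elim: l => // x [|y [|z l]] IH //=; first by move=> [].
by move=> [xy xz /IH r].
Qed.

Lemma reduced_catr l m : reduced (l ++ m) -> reduced m.
Proof. by elim: l => // x l IH /reduced_behead. Qed.

(** Cancel backtracking at the junction, one vertex at a time. A prefix of [p] and a suffix of [q]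
    survive, which is the form needed to keep track of fixed pieces. *)
Lemma reduced_join x p q : reduced (x :: p) -> reduced (last x p :: q) ->
  exists p1 p2 q1 q2, [/\ p = p1 ++ p2, q = q1 ++ q2,
    reduced (x :: p1 ++ q2) & last x p1 = last (last x p) q1].
Proof.
elim/last_ind: p q => [|p y IH] q; first by exists [::], [::], [::], q.
rewrite last_rcons; case: q => [|z q] rp rq.
  by exists (rcons p y), [::], [::], [::]; rewrite !cats0 last_rcons.
have [zp|zp] := pselect (last x p = z).
  have rp' : reduced (x :: p) by apply: (@reduced_catl _ [:: y]); rewrite cat_cons cats1.
  have [|p1 [p2 [q1 [q2 [pE qE r e]]]]] := IH q rp'.
    by rewrite zp; exact: reduced_behead rq.
  exists p1, (rcons p2 y), (z :: q1), q2; split=> // /=; rewrite ?pE ?qE ?rcons_cat //.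
  by rewrite e zp.
exists (rcons p y), [::], [::], (z :: q); rewrite cats0; split=> //; last first.
  by rewrite last_rcons.
rewrite cat_rcons -cat_cons lastI cat_rcons; rewrite reduced_cat2.
split; first by rewrite -cat_rcons -lastI cat_cons cats1.
split=> //; have := rp; rewrite -cats1 -cat_cons lastI cat_rcons.
by case/reduced_catr.
Qed.

Hypothesis acyclic : forall x y l, reduced [:: x, y & l] -> last y l <> x.

(** If the first steps differ, the reverse of one path followed by the other is reduced and closed,
    against [acyclic]. *)
Lemma reduced_unique x p q : reduced (x :: p) -> reduced (x :: q) ->
  last x p = last x q -> p = q.
Proof.
elim: p x q => [|y p IH] x [|z q] //.
- by move=> _ /acyclic r /esym.
- by move=> /acyclic.
move=> rp rq e; have [yz|yz] := pselect (y = z).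
  rewrite yz (IH z q) //; [|exact: reduced_behead rq|by move: e; rewrite /= yz].
  by rewrite -yz; exact: reduced_behead rp.
have xy : adj x y by case: rp.
have r : reduced (rev p ++ [:: y, x, z & q]).
  rewrite reduced_cat2; split; last by split=> //; exact: adj_sym.
  by have := reduced_rev rp; rewrite !rev_cons -!cats1 -catA.
case/lastP: p IH rp r e => [|p w] _ _ /=; first by move=> r e; case: (@acyclic y x (z :: q) r).
rewrite rev_rcons last_rcons => + e; case: (rev p) => [|v p'] r.
  by case: (@acyclic w y [:: x, z & q] r).
by case: (@acyclic w v (p' ++ [:: y, x, z & q]) r); rewrite last_cat.
Qed.

Definition connected_vertices x y := exists2 p, reduced (x :: p) & last x p = y.

Lemma connected_trans x y z :
  connected_vertices x y -> connected_vertices y z -> connected_vertices x z.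
Proof.
move=> [p rp <-] [q rq <-].
have [p1 [p2 [q1 [q2 [_ -> r e]]]]] := reduced_join rp rq.
by exists (p1 ++ q2) => //; rewrite !last_cat e.
Qed.

Lemma connected_sym x y : connected_vertices x y -> connected_vertices y x.
Proof.
move=> [p rp <-].
have E : rev (x :: p) = last x p :: rev (belast x p) by rewrite lastI rev_rcons.
exists (rev (belast x p)); first by rewrite -E; exact: reduced_rev.
by have := congr1 (last x) E; rewrite rev_cons last_rcons.
Qed.

Section Action.
Local Open Scope group_scope.
Variables (gT : groupType) (act : gT -> X -> X).
Hypothesis actM : forall g h x, act (g * h) x = act g (act h x).
Hypothesis act1 : forall x, act 1 x = x.
Hypothesis act_adj : forall g x y, adj x y -> adj (act g x) (act g y).

Lemma act_inj g : injective (act g).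
Proof. by move=> x y e; rewrite -[x]act1 -[y]act1 -(mulVg g) !actM e. Qed.

Lemma reduced_act g l : reduced l -> reduced (map (act g) l).
Proof.
elim: l => // x [|y l] IH //= [xy xl /IH r]; split=> //; first exact: act_adj.
by case: l xl {IH r} => // z l xz /act_inj.
Qed.

(** The image path is reduced with the same ends, so uniqueness applies. *)
Lemma act_fix_path g x p : reduced (x :: p) -> act g x = x ->
  act g (last x p) = last x p -> map (act g) p = p.
Proof.
move=> r gx gl; apply: (@reduced_unique x) => //; last by rewrite -{1}gx last_map.
by rewrite -{1}gx -map_cons; exact: reduced_act.
Qed.

Lemma map_fix_cat (f : X -> X) p q :
  map f (p ++ q) = p ++ q <-> map f p = p /\ map f q = q.
Proof.
rewrite map_cat; split=> [e|[-> ->] //].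
have sz : size (map f p) = size p by rewrite size_map.
split; first by have := congr1 (take (size p)) e; rewrite !take_size_cat.
by have := congr1 (drop (size p)) e; rewrite !drop_size_cat.
Qed.

(** Walk from [y] towards [x] as long as [h] fixes the next vertex. Once [h] moves it, the path from
    [x] back to [y] and on to [act h x] is reduced; [g] fixes both its ends, as it commutes with
    [h], and hence fixes [y]. *)
Lemma common_fixed_vertex g h x y : connected_vertices y x ->
  g * h = h * g -> act g x = x -> act h y = y ->
  exists z, [/\ connected_vertices y z, act g z = z & act h z = z].
Proof.
move=> [p + <-] gh; elim: p y => [|z p IH] y r gx hy.
  by exists y; split=> //; exists [::].
have yz : adj y z by case: r.
have [hz|hz] := pselect (act h z = z).
  have [v [zv gv hv]] := IH z (reduced_behead r) gx hz.
  by exists v; split=> //; apply: connected_trans zv; exists [:: z].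
have rr : reduced (rev p ++ [:: z, y & map (act h) (z :: p)]).
  rewrite reduced_cat2; split.
    by have := reduced_rev r; rewrite !rev_cons -!cats1 -catA.
  split; [exact: adj_sym | by move=> e; apply: hz |].
  by rewrite -{1}hy -map_cons; exact: reduced_act.
exists y; split=> //; first by exists [::].
move: gx rr => /=; set w := last z p => gw.
have ghw : act g (act h w) = act h w by rewrite -actM gh actM gw.
have -> : rev p ++ [:: z, y, act h z & map (act h) p] =
    rev (z :: p) ++ [:: y, act h z & map (act h) p].
  by rewrite rev_cons cat_rcons.
rewrite lastI rev_rcons -/w cat_cons => rr.
have := act_fix_path rr gw; rewrite last_cat /= last_map -/w => /(_ ghw).
by case/map_fix_cat => _ /= [].
Qed.

Variable mirror : gT -> Prop.

(** The list omits the starting vertex of the path. Pieces may be empty, so [n] acts as an upper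
    bound. *)
Inductive covered : nat -> seq X -> Prop :=
| covered0 : covered 0 [::]
| coveredS n p q r of covered n p & mirror r & map (act r) q = q :
    covered n.+1 (p ++ q).

Lemma cat_eq_cat p q p' q' : p ++ q = p' ++ q' ->
  (exists2 r, p' = p ++ r & q = r ++ q') \/ (exists2 r, p = p' ++ r & q' = r ++ q).
Proof.
elim: p p' => [|x p IH] [|x' p'] /=.
- by move=> ->; left; exists [::].
- by move=> ->; left; exists (x' :: p').
- by move=> <-; right; exists (x :: p).
- by move=> [-> /IH[[r -> ->]|[r -> ->]]]; [left|right]; exists r.
Qed.

Lemma covered_catl n p q : covered n (p ++ q) -> covered n p.
Proof.
move e : (p ++ q) => l c; elim: c p q e => {n l} [|n p' q' r c IH mr fq] p q e.
  by case: p e => // _; exact: covered0.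
have [[p2 p'E _]|[q1 -> q'E]] := cat_eq_cat e.
  by rewrite -[p]cats0; apply: (coveredS (r := r)) => //; exact: IH (esym p'E).
apply: (coveredS (r := r)) => //.
by move: fq; rewrite q'E => /map_fix_cat[].
Qed.

Lemma covered_join n r x p q : reduced (x :: p) -> reduced (last x p :: q) ->
  covered n p -> mirror r -> map (act r) q = q ->
  exists p', [/\ reduced (x :: p'), last x p' = last (last x p) q & covered n.+1 p'].
Proof.
move=> rp rq cp mr fq.
have [p1 [p2 [q1 [q2 [pE qE rpq e]]]]] := reduced_join rp rq.
exists (p1 ++ q2); split=> //; first by rewrite qE !last_cat e.
apply: (coveredS (r := r)) => //; first by move: cp; rewrite pE; exact: covered_catl.
by move: fq; rewrite qE => /map_fix_cat[].
Qed.

(** The last piece cannot contain the last block, so the earlier pieces already cover all the other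
    blocks; the trailing [p] absorbs the remainder in this induction. *)
Lemma covered_blocks (b : nat -> seq X) N n p :
  (forall i, b i <> [::]) -> (forall i r, mirror r -> map (act r) (b i) <> b i) ->
  covered n (flatten (mkseq b N) ++ p) -> N <= n.
Proof.
move=> b0 bmr; move e : (flatten _ ++ p) => l c.
elim: c N p e => {n l} [|n p' q' r c IH mr fq] [|N] p //.
  rewrite mkseqS flatten_rcons; have := b0 N; case: (b N) => // x l _.
  by move/(congr1 size); rewrite !size_cat /= addnS.
rewrite mkseqS flatten_rcons -catA => e; rewrite ltnS.
have [[p2 p'E _]|[p2 _ q'E]] := cat_eq_cat e; first exact: IH (esym p'E).
by move: fq; rewrite q'E => /map_fix_cat[_ /map_fix_cat[+ _]] => /(bmr _ _ mr).
Qed.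

End Action.
End ReducedPaths.

(** * The Bass-Serre tree of an amalgam *)

Section CosetTree.
Local Open Scope group_scope.
Variables (gT : groupType) (H : bool -> set gT).
Hypothesis sH : forall e, is_subgroup (H e).
Local Notation C := (amalgamated H).
Hypothesis alternateN : forall e x l,
  alternate H e (x :: l) -> ~ C (\prod_(y <- x :: l) y).
Implicit Types (e : bool) (g h : gT) (x : bool * set gT).

(** Left cosets are tagged by their side; an edge will be the pair of cosets of one [g], that is, a
    coset [g C]. *)
Definition coset_vertex e g : bool * set gT := (e, [set g * h | h in H e]%classic).

Definition translate g x : bool * set gT := (x.1, [set g * h | h in x.2]%classic).

Definition coset_adj x y := exists e g, x = coset_vertex e g /\ y = coset_vertex (~~ e) g.

Lemma coset_adj_sym x y : coset_adj x y -> coset_adj y x.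
Proof. by move=> [e [g [-> ->]]]; exists (~~ e), g; rewrite negbK. Qed.

Lemma translateM g h x : translate (g * h) x = translate g (translate h x).
Proof.
congr pair; apply/seteqP; split=> [_ [y xy <-]|_ [_ [y xy <-] <-]].
  by exists (h * y); rewrite ?mulgA //; exists y.
by exists y; rewrite ?mulgA.
Qed.

Lemma translate1 x : translate 1 x = x.
Proof.
case: x => e U; congr pair; apply/seteqP; split=> [_ [y Uy <-]|y Uy].
  by rewrite mul1g.
by exists y; rewrite ?mul1g.
Qed.

Lemma translate_vertex g e h : translate g (coset_vertex e h) = coset_vertex e (g * h).
Proof.
congr pair; apply/seteqP; split=> [_ [_ [y Hy <-] <-]|_ [y Hy <-]].
  by exists y; rewrite ?mulgA.
by exists (h * y); rewrite ?mulgA //; exists y.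
Qed.

Lemma translate_adj g x y : coset_adj x y -> coset_adj (translate g x) (translate g y).
Proof. by move=> [e [h [-> ->]]]; exists e, (g * h); rewrite !translate_vertex. Qed.

Lemma coset_vertexP e g e' h :
  coset_vertex e g = coset_vertex e' h <-> e = e' /\ H e (g^-1 * h).
Proof.
split=> [[<- E]|[<- Hgh]]; first split=> //.
  have : [set h * y | y in H e]%classic h by exists 1; rewrite ?mulg1 //; exact: (sH e).1.
  by rewrite -E => -[y Hy <-]; rewrite mulKg.
congr pair; apply/seteqP; split=> _ [y Hy <-].
  exists (h^-1 * g * y); last by rewrite !mulgA mulgV mul1g.
  by apply: is_subgroupM => //; rewrite -[h^-1 * g]invgK invgM invgK; exact: is_subgroupV.
by exists (g^-1 * h * y); rewrite ?mulgA ?mulgV ?mul1g //; exact: is_subgroupM.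
Qed.

Lemma translate_fix r e g :
  translate r (coset_vertex e g) = coset_vertex e g <-> H e (g^-1 * r * g).
Proof.
rewrite translate_vertex; split=> [/esym/coset_vertexP[_]|]; first by rewrite mulgA.
by move=> Hr; apply/esym/coset_vertexP; rewrite mulgA.
Qed.

(** Consecutive edges [g C] and [g' C] share a vertex, so [g^-1 * g'] lies on one side; the absence
    of backtracking keeps it out of [C]. *)
Lemma reduced_alternate e g l :
  reduced coset_adj [:: coset_vertex e g, coset_vertex (~~ e) g & l] ->
  exists2 m, alternate H (~~ e) m &
    size m = size l /\
    last (coset_vertex (~~ e) g) l =
      coset_vertex (if odd (size l) then e else ~~ e) (g * \prod_(y <- m) y).
Proof.
elim: l e g => [|z l IH] e g; first by exists [::] => //; rewrite big_nil mulg1.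
move=> [_ ez r].
have [e' [g' [/[dup] vE /coset_vertexP[ee' Hg'] zE]]] :
  coset_adj (coset_vertex (~~ e) g) z by case: r.
subst e'; rewrite negbK in zE; subst z.
have [|m am [sm lm]] := IH (~~ e) g'; first by rewrite negbK -vE.
exists (g^-1 * g' :: m).
  split=> //; case/(amalgamatedP _ e) => He _; apply: ez.
  exact/coset_vertexP.
rewrite /= sm; split=> //; rewrite big_cons mulgA mulgA mulgV mul1g.
by move: lm; rewrite !negbK /= => ->; case: odd.
Qed.

(** A closed reduced path yields an alternating product [p] lying in [H e]. Prefixing [p^-1] gives a
    longer alternating product equal to 1, which [alternateN] forbids. *)
Lemma coset_acyclic x y l : reduced coset_adj [:: x, y & l] -> last y l <> x.
Proof.
move=> r; have [e [g [xE yE]]] : coset_adj x y by case: r.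
subst x y; have [m am [sm ->]] := reduced_alternate r.
case/coset_vertexP; case: ifP => [ol|_ /esym]; last by case: (e).
move=> _; rewrite invgM -mulgA mulVg mulg1 => /(is_subgroupV (sH e)); rewrite invgK.
case: m am sm => [_ s0|h m am _ He]; first by rewrite -s0 in ol.
have Cm := alternateN am; set p := \prod_(_ <- _) _ in He Cm.
have Hp : H e p^-1 by exact: is_subgroupV.
have /alternateN : alternate H e (p^-1 :: h :: m).
  split=> // Cp; apply: Cm; rewrite -[p]invgK.
  by apply: is_subgroupV => //; exact: amalgamated_subgroup.
by apply; rewrite big_cons mulVg; exact: (amalgamated_subgroup sH).1.
Qed.

Hypothesis H_generate : forall K : set gT, is_subgroup K ->
  (forall e, (H e `<=` K)%classic) -> forall g, K g.

(** The elements moving the base vertex within its component form a subgroup containing both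
    sides. *)
Lemma coset_connected e g e' h :
  connected_vertices coset_adj (coset_vertex e g) (coset_vertex e' h).
Proof.
have refl x : connected_vertices coset_adj x x by exists [::].
have sym := connected_sym coset_adj_sym.
have trans := connected_trans (adj := coset_adj).
have edge f k : connected_vertices coset_adj (coset_vertex f k) (coset_vertex (~~ f) k).
  by exists [:: coset_vertex (~~ f) k] => //; split=> //; exists f, k.
have move_ k x y : connected_vertices coset_adj x y ->
    connected_vertices coset_adj (translate k x) (translate k y).
  move=> [p rp <-]; exists (map (translate k) p); last by rewrite last_map.
  exact: (reduced_act translateM translate1 translate_adj k rp).
have true_ f k : connected_vertices coset_adj (coset_vertex true k) (coset_vertex f k).
  by case: f => //; exact: edge.
suff base k : connected_vertices coset_adj (coset_vertex true 1) (coset_vertex true k).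
  apply: (trans _ (coset_vertex true g)); first by apply: sym; exact: true_.
  apply: (trans _ (coset_vertex true h)); last exact: true_.
  by apply: (trans _ (coset_vertex true 1)) => //; apply: sym.
apply: (H_generate (K := [set k | connected_vertices coset_adj
  (coset_vertex true 1) (coset_vertex true k)]%classic)) => [|f {}k Hk] /=.
  split=> //= a b ha hb; apply: (trans _ _ _ ha).
  have := move_ (a * b^-1) _ _ hb.
  by rewrite !translate_vertex mulg1 mulgVK => /sym.
apply: (trans _ (coset_vertex f 1)); first exact: true_.
rewrite (_ : coset_vertex f 1 = coset_vertex f k); first by apply: sym; exact: true_.
by apply/coset_vertexP; rewrite invg1 mul1g.
Qed.

End CosetTree.

(** * Blocks of the tree fixed by no reflection *)

Section Blocks.
Local Open Scope group_scope.
Variables (R : realType) (G : labeled_graph) (s t : G).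
Hypotheses (s_neq_t : s != t) (st_nonadj : ~~ adjacent_vertices s t).
Local Notation A := (artin_group G).
Local Notation H := (side s).
Local Notation C := (amalgamated (side s)).
Implicit Types (w u : G) (ws : seq G) (g r : A) (v : G -> R).

Let sH := side_subgroup s.
Let gactM := gact_mul (@artin_coxeter G) (R := R).
Let gactG := gact_gen (@artin_coxeter G) (R := R).
Let gactGV := gact_genV (@artin_coxeter G) (R := R).

Let t_star : t \notin star s.
Proof. by rewrite inE negb_or eq_sym s_neq_t. Qed.

Lemma gen_side_true w : w != s -> H true (artin_gen w).
Proof. by move=> ws; apply: standard_parabolic_gen; rewrite !inE. Qed.

Lemma gen_side_false : H false (artin_gen s).
Proof. by apply: standard_parabolic_gen; rewrite inE eqxx. Qed.

Lemma gen_notin_side : ~ H true (artin_gen s).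
Proof. by move=> /(gen_notin_parabolic R); rewrite !inE eqxx. Qed.

(* The case distinction keeps [twist w] out of [H false]: t * t could lie in it
   as far as the geometric representation can tell. *)
Definition twist w : A := if w == t then artin_gen t else artin_gen w * artin_gen t.

Lemma twist_side w : w != s -> H true (twist w).
Proof.
move=> ws; rewrite /twist; case: eqP => _.
  by apply: gen_side_true; rewrite eq_sym.
by apply: (is_subgroupM (sH _)) => //; apply: gen_side_true => //; rewrite eq_sym.
Qed.

Lemma twist_notin_side w : ~ H false (twist w).
Proof.
rewrite /twist; case: eqP => [_|/eqP wt].
  by move=> /(gen_notin_parabolic R); rewrite (negbTE t_star).
move=> Ht; have := gact_parabolic (simple_root R t) Ht t_star.
rewrite gactM !gactG srefl_neq 1?eq_sym //.
rewrite /srefl pairing_simple_root cosine_id /simple_root eqxx /=.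
by lra.
Qed.

(** The starting vertex, the coset of [g] on side [true], is left out. Each letter adds two edges,
    turning by [twist w] in [H true] and then by [s] in [H false]. *)
Fixpoint block g ws : seq (bool * set A) :=
  if ws is w :: ws' then
    [:: coset_vertex H false (g * twist w),
        coset_vertex H true (g * twist w * artin_gen s)
      & block (g * twist w * artin_gen s) ws']
  else [::].

Definition advance g ws := foldl (fun g w => g * twist w * artin_gen s) g ws.

Lemma block_cat g ws ws' : block g (ws ++ ws') = block g ws ++ block (advance g ws) ws'.
Proof. by elim: ws g => //= w ws IH g; rewrite IH. Qed.

Lemma advance_mul g h ws : advance (g * h) ws = g * advance h ws.
Proof. by elim: ws h => //= w ws IH h; rewrite -!mulgA IH !mulgA. Qed.

Lemma last_block g ws :
  last (coset_vertex H true g) (block g ws) = coset_vertex H true (advance g ws).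
Proof. by elim: ws g => //=. Qed.

(** Backtracking would put [s] into [H true] or [twist w] into [H false]. *)
Lemma block_reduced g ws : all (fun w => w != s) ws ->
  reduced (coset_adj H) (coset_vertex H true g :: block g ws).
Proof.
elim: ws g => // w ws IH g /= /andP[ws_ wss].
set g1 := g * twist w; set g2 := g1 * artin_gen s.
have E1 : coset_vertex H true g = coset_vertex H true g1.
  by apply/(coset_vertexP sH); split=> //; rewrite mulKg; exact: twist_side.
have E2 : coset_vertex H false g1 = coset_vertex H false g2.
  by apply/(coset_vertexP sH); split=> //; rewrite mulKg; exact: gen_side_false.
split; first by exists true, g1.
  rewrite E1 => /(coset_vertexP sH)[_]; rewrite mulKg; exact: gen_notin_side.
have := IH g2 wss; case: ws {IH wss} => [_|w' ws] /=.
  by split=> //; exists false, g2.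
move=> r; split=> //; first by exists false, g2.
by rewrite E2 => /(coset_vertexP sH)[_]; rewrite mulKg; exact: twist_notin_side.
Qed.

Definition reflection r := exists g u, r = g * artin_gen u * g^-1.

Section FixedBlock.
Variables (x : A) (u : G).
Let r := x * artin_gen u * x^-1.
(** The root of [g^-1 * r * g], that is, the root of [r] seen from the edge [g C]. *)
Let root g : G -> R := gact (g^-1 * x) (simple_root R u).

Let root_self g : coxform (root g) (root g) = 1%R.
Proof. by rewrite coxform_gact // coxform_simple_root pairing_simple_root cosine_id. Qed.

Let root_mul g h : root (g * h) = gact h^-1 (root g).
Proof. by rewrite /root invgM -mulgA gactM. Qed.

(** The conjugate negates [root g]. Lying on both sides, it also preserves the [s]-coordinate, as
    [H true] avoids [s], and the [t]-coordinate, as the star avoids [t]. *)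
Let edge_root g : C (g^-1 * r * g) -> root g s = 0%R /\ root g t = 0%R.
Proof.
move=> [Ht Hf].
have E y : gact (g^-1 * r * g) (root g) y = (- root g y)%R.
  have -> : g^-1 * r * g = (g^-1 * x) * artin_gen u * (g^-1 * x)^-1.
    by rewrite invgM invgK !mulgA.
  by rewrite (gact_conj (@artin_coxeter G)) -/(root g) root_self; ring.
have := gact_parabolic (root g) Ht (u := s); have := gact_parabolic (root g) Hf t_star.
by rewrite !E !inE eqxx => ? /(_ isT) ?; split; lra.
Qed.

Fixpoint walls v ws : Prop :=
  if ws is w :: ws' then
    [/\ pairing (srefl w v) s = 0%R, pairing (srefl w v) t = 0%R & walls (srefl w v) ws']
  else True.

Let fix_true g : translate r (coset_vertex H true g) = coset_vertex H true g ->
  H true (g^-1 * r * g).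
Proof. by move/(translate_fix sH). Qed.

Let fix_false g : translate r (coset_vertex H false g) = coset_vertex H false g ->
  H false (g^-1 * r * g).
Proof. by move/(translate_fix sH). Qed.

Let conj_side e g h : H e h -> H e (g^-1 * r * g) -> H e ((g * h)^-1 * r * (g * h)).
Proof.
move=> Hh Hg; have -> : (g * h)^-1 * r * (g * h) = h^-1 * (g^-1 * r * g * h).
  by rewrite invgM !mulgA.
apply: (is_subgroupM (sH _)) => //; first exact: (is_subgroupV (sH _)).
exact: (is_subgroupM (sH _)).
Qed.

(** Every edge along the block is fixed, so the [s]- and [t]-coordinates of the root vanish
    throughout. A reflection in [t] or [s] that keeps its own coordinate zero acts trivially, so
    each step moves the root by [w] alone. *)
Lemma fixed_block_walls g ws : all (fun w => w != s) ws ->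
  map (translate r) (block g ws) = block g ws ->
  C (g^-1 * r * g) -> walls (root g) ws.
Proof.
elim: ws g => // w ws IH g /= /andP[ws_ wss] [].
move=> e1 e2 fws [Cg1 Cg2]; have f1 := fix_false (congr1 (pair false) e1).
have f2 := fix_true (congr1 (pair true) e2).
set g1 := g * twist w in f1 f2 fws; set g2 := g1 * artin_gen s in f2 fws.
have C1 : C (g1^-1 * r * g1) by split=> //; apply: conj_side => //; exact: twist_side.
have C2 : C (g2^-1 * r * g2).
  by split=> //; apply: conj_side => //; exact: gen_side_false.
have := IH g2 wss fws C2.
have [v1s v1t] := edge_root C1; have [v2s v2t] := edge_root C2.
have [vs vt] := edge_root (conj Cg1 Cg2).
set v := root g in vs vt *.
have v2E : root g2 = srefl s (root g1) by rewrite root_mul gactGV.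
have [v1E ft] : root g1 = srefl w v /\ pairing (srefl w v) t = 0%R.
  rewrite /g1 root_mul -/v in v1t *; rewrite /twist in v1t *.
  case: eqP v1t => [->|/eqP wt]; rewrite ?invgM ?gactM !gactGV => v1t.
    split=> //; have ft : pairing v t = 0%R.
      by move: v1t; rewrite /srefl /simple_root eqxx vt /=; lra.
    by rewrite srefl_fix.
  have ft : pairing (srefl w v) t = 0%R.
    move: v1t; rewrite {1}/srefl srefl_neq 1?eq_sym // vt /simple_root eqxx /=; lra.
  by split; first exact: srefl_fix.
have fs : pairing (srefl w v) s = 0%R.
  by move: v2s; rewrite v2E -v1E /srefl v1s /simple_root eqxx /=; lra.
by rewrite v2E v1E srefl_fix.
Qed.

Lemma fixed_block ws g : all (fun w => w != s) ws ->
  (forall v, walls v ws -> forall y, pairing v y = 0%R) ->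
  map (translate r) (block g (t :: ws)) <> block g (t :: ws).
Proof.
move=> wss kill /= [].
move=> e1 e2 fws; have f1 := fix_false (congr1 (pair false) e1).
have f2 := fix_true (congr1 (pair true) e2).
set g2 := g * twist t * artin_gen s in f2 fws.
(* The leading [t] supplies two consecutive fixed vertices, hence a fixed edge from which the walls
   start. *)
have C2 : C (g2^-1 * r * g2).
  by split=> //; apply: conj_side => //; exact: gen_side_false.
have := kill _ (fixed_block_walls wss fws C2) => f0.
have := root_self g2; rewrite /coxform big1 => [|y _]; last by rewrite f0 mulr0.
by lra.
Qed.

End FixedBlock.

Definition run v ws := foldl (fun v w => srefl w v) v ws.

Lemma walls_cat v ws ws' :
  walls v (ws ++ ws') <-> walls v ws /\ walls (run v ws) ws'.
Proof.
elim: ws v => [|w ws IH] v /=; first by split=> [|[]].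
by split=> [[? ? /IH[]]|[[? ? ?] ?]] //; split=> //; exact/IH.
Qed.

(** Since the word returns every vector to itself, such words can be concatenated and their
    conclusions all concern the same [v]. *)
Definition closed_kill ws y := [/\ all (fun w => w != s) ws,
  forall v, run v ws = v & forall v, walls v ws -> pairing v y = 0%R].

(* If v and its image under w are both orthogonal to e_y, and e_y is not
   orthogonal to e_w, then v is orthogonal to e_w; so words can be found by
   propagation along the Coxeter diagram, starting from s and t. *)
Lemma closed_kill_exists : irreducible [set: G]%SET ->
  forall y, exists ws, closed_kill ws y.
Proof.
move=> [_ irr].
pose Z : {set G} := [set y | `[< exists ws, closed_kill ws y >]].
(* The first [t] gives orthogonality to the root of [t]; its reflection then fixes [v], so the
   condition at [s] holds for [v] itself. *)
have st_kill y : y \in [set s; t]%SET -> closed_kill [:: t; t] y.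
  move=> yst; split=> [|v|v]; first by rewrite /= eq_sym s_neq_t.
    exact: sreflK.
  move=> [fs ft _]; have ft' : pairing v t = 0%R.
    by move: ft; rewrite pairing_srefl cosine_id; lra.
  move: fs; rewrite srefl_fix // => fs.
  by move: yst; rewrite !inE => /orP[/eqP->|/eqP->].
have sZ : s \in Z.
  by rewrite inE; apply/asboolP; exists [:: t; t]; apply: st_kill; rewrite !inE eqxx.
suff ZT : Z = [set: G]%SET.
  by move=> y; have : y \in Z by [rewrite ZT finset.in_setT]; rewrite inE => /asboolP.
(* Otherwise only labels 2 would join [Z] to its complement, against irreducibility. *)
apply: contra_notP irr => /eqP ZT; exists Z, (~: Z)%SET; split.
  split; [exact: finset.setUCr | exact: finset.setICr | by apply/set0Pn; exists s |].
  by apply: contra ZT => /eqP Z0; rewrite -[Z]finset.setCK Z0 finset.setC0.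
move=> y w; rewrite [in X in X -> _]inE finset.in_setC => /asboolP[wy [wys wyR wyK]] wZ.
apply: contrapT => /(cosine_neq0 R) yw; move/negP: (wZ); apply; rewrite inE.
have ws : w != s by apply: contraNneq wZ => ->.
(* The first half makes [srefl w v] orthogonal to the root of [y]; the second returns to [v] and
   does the same for [v]. Subtracting leaves the pairing with [w] times a nonzero cosine. *)
apply/asboolP; exists (w :: wy ++ w :: wy); split=> [|v|v].
- by rewrite /= all_cat /= ws wys.
- have -> : run v (w :: wy ++ w :: wy) = run (srefl w (run (srefl w v) wy)) wy.
    by rewrite /run /= foldl_cat.
  by rewrite !wyR sreflK.
- move=> [_ _ /walls_cat[/wyK + [_ _]]].
  rewrite wyR sreflK pairing_srefl => f /wyK f0; move/eqP: f.
  rewrite f0 sub0r oppr_eq0 cosineC mulf_eq0 (negbTE yw) orbF mulf_eq0 pnatr_eq0 /=.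
  by move/eqP.
Qed.

Lemma closed_kill_all : irreducible [set: G]%SET ->
  exists2 ws, all (fun w => w != s) ws &
    forall v, walls v ws -> forall y, pairing v y = 0%R.
Proof.
move=> irr; suff [ws [wss _ K]] : exists ws, [/\ all (fun w => w != s) ws,
    forall v, run v ws = v &
    forall v, walls v ws -> forall y, y \in enum G -> pairing v y = 0%R].
  by exists ws => // v /K f0 y; apply: f0; rewrite mem_enum.
elim: (enum G) => [|y l [ws [wss wsR wsK]]]; first by exists [::].
have [wy [wys wyR wyK]] := closed_kill_exists irr y.
exists (wy ++ ws); split=> [|v|v]; first by rewrite all_cat wys.
  by rewrite /run foldl_cat [X in foldl _ X]wyR.
move=> /walls_cat[/wyK fy]; rewrite wyR => /wsK fl z.
by rewrite inE => /orP[/eqP->//|]; exact: fl.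
Qed.

(** One word serves all reflections and all starting points [g], so the block can be repeated along
    an axis. *)
Lemma unfixed_block : irreducible [set: G]%SET ->
  exists2 ws, all (fun w => w != s) ws & ws <> [::] /\
    forall r g, reflection r -> map (translate r) (block g ws) <> block g ws.
Proof.
move=> /closed_kill_all[ws wss K]; exists (t :: ws).
  by rewrite /= wss eq_sym s_neq_t.
by split=> // r g [x [u ->]]; exact: fixed_block.
Qed.

End Blocks.

(** * Distances in the complex of parabolic subgroups *)

Section Distances.
Local Open Scope group_scope.
Variables (R : realType) (G : labeled_graph) (s t : G).
Hypotheses (s_neq_t : s != t) (st_nonadj : ~~ adjacent_vertices s t).
Hypothesis G_irr : irreducible [set: G]%SET.
Local Notation A := (artin_group G).
Local Notation H := (side s).
Local Notation base := (coset_vertex H true (1 : A)).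
Local Notation connected := (connected_vertices (coset_adj H)).
Implicit Types (P Q : set A) (x y z : bool * set A).

Let sH := side_subgroup s.
Let acyclic := coset_acyclic sH (alternate_notin_amalgamated sH (artin_act_extends s)).
Let adj_sym := @coset_adj_sym _ H.
Let trans := connected_trans (adj := coset_adj H).
Let sym := connected_sym adj_sym.

Let connected_coset e g : connected base (coset_vertex H e g).
Proof.
apply: (coset_connected sH) => K sK HK {}g.
have genK u : K (artin_gen u).
  have [->|us] := eqVneq u s; first exact: (HK false _ (@gen_side_false _ s)).
  exact: (HK true _ (@gen_side_true _ s _ us)).
elim/pres_ind: g => [|u g Kg|u g Kg]; first exact: sK.1.
  by apply: (is_subgroupM sK) => //; exact: genK.
apply: (is_subgroupM sK) => //; apply: (is_subgroupV sK); exact: genK.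
Qed.

Definition fixed_by P x := forall p, P p -> translate p x = x.

(** A clique containing [s] lies in its star, and any other clique avoids [s]; so [P] is conjugate
    into one side. *)
Lemma parabolic_fixed P : irreducible_finite_type_parabolic P ->
  (exists2 x, connected base x & fixed_by P x) /\
  exists2 r, P r & reflection r.
Proof.
move=> [g [T [-> [T0 _] fT]]]; have cT := finite_type_clique R fT; split.
  have [e Te] : exists e, T \subset side_vertices s e.
    have [sT|sT] := boolP (s \in T); [exists false|exists true];
      apply/fintype.subsetP => u uT; rewrite !inE.
      by case: eqVneq => //= us; apply: cT => //; rewrite eq_sym.
    by apply: contraNneq sT => <-.
  exists (coset_vertex H e g); first exact: connected_coset.
  move=> _ [a Ta <-]; apply/(translate_fix sH).
  rewrite -mulgA mulgVK mulKg.
  exact: standard_parabolic_sub Ta.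
have /set0Pn[u uT] := T0.
exists (g * artin_gen u * g^-1); last by exists g, u.
by exists (artin_gen u) => //; exact: standard_parabolic_gen.
Qed.

Let covers n x y := exists2 p, reduced (coset_adj H) (x :: p) &
  last x p = y /\ covered (@translate A) (@reflection G) n p.

Let covers0 x : covers 0 x x.
Proof. by exists [::] => //; split=> //; exact: covered0. Qed.

Let coversS n x y z r : covers n x y -> connected y z -> reflection r ->
  translate r y = y -> translate r z = z -> covers n.+1 x z.
Proof.
move=> [p rp [<- cp]] [q rq <-] refl_r fy fz.
have fq := act_fix_path (adj_sym) acyclic (@translateM _) (@translate1 _)
  (@translate_adj _ H) rq fy fz.
have [p' [rp' lp' cp']] := covered_join rp rq cp refl_r fq.
by exists p'.
Qed.

Let covers_le m n x y : covers m x y -> m <= n -> covers n x y.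
Proof.
move=> [p rp [lp cp]] mn; exists p => //; split=> //.
elim: n mn => [|n IH]; first by rewrite leqn0 => /eqP m0; rewrite -m0.
rewrite leq_eqVlt => /orP[/eqP<-//|]; rewrite ltnS => /IH cn.
rewrite -[p]cats0; apply: (coveredS (r := artin_gen s)) => //.
by exists 1, s; rewrite mul1g invg1 mulg1.
Qed.

(** Each edge of the complex costs at most two pieces, and one last piece joins two vertices fixed
    by [Q]. *)
Lemma edge_path_covers n P Q m z x y :
  edge_path (parabolic_complex G) n P Q ->
  irreducible_finite_type_parabolic P ->
  connected base x -> connected base y -> fixed_by P x -> fixed_by Q y ->
  covers m z x -> covers (m + n.*2.+1) z y.
Proof.
move=> path; elim: path m x => {n P Q} [P|n P P' Q [PP' K] _ IH] m x Pirr bx b_y Px Qy mx.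
  have [_ [r Pr refl_r]] := parabolic_fixed Pirr.
  have xy : connected x y by apply: trans b_y; exact: sym.
  by rewrite addn1; exact: (coversS mx xy refl_r (Px _ Pr) (Qy _ Pr)).
have [P'irr _] : irreducible_finite_type_parabolic P' /\ P' <> [set: A]%classic.
  by case: K => _ _ + _; apply; right.
have [_ [r Pr refl_r]] := parabolic_fixed Pirr.
have [[x' bx' P'x'] [r' P'r' refl_r']] := parabolic_fixed P'irr.
have xx' : connected x x' by apply: trans bx'; exact: sym.
suff mx' : covers (m + 2) z x'.
  by have := IH _ _ P'irr bx' b_y P'x' Qy mx'; rewrite -addnA doubleS.
have [[[PP'sub _]|[P'Psub _]]|[_ PC]] : adjacent_parabolics P P'.
- by case: K => _ _ _; apply; [left|right|].
(* For nested subgroups, a reflection of the smaller one fixes both vertices. *)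
- apply: (@covers_le m.+1); last by rewrite addn2.
  exact: (coversS mx xx' refl_r (Px _ Pr) (P'x' _ (PP'sub _ Pr))).
- apply: (@covers_le m.+1); last by rewrite addn2.
  exact: (coversS mx xx' refl_r' (Px _ (P'Psub _ P'r')) (P'x' _ P'r')).
(* For commuting subgroups the path goes through a vertex fixed by both reflections. *)
have [v [xv r'v rv]] := common_fixed_vertex adj_sym acyclic (@translateM _)
  (@translate1 _) (@translate_adj _ H) xx' (esym (PC _ _ Pr P'r')) (P'x' _ P'r') (Px _ Pr).
rewrite addn2; apply: (coversS (coversS mx xv refl_r (Px _ Pr) rv) _ refl_r' r'v).
  by apply: trans xx'; exact: sym.
exact: P'x'.
Qed.

Let conj_parabolic (g : A) : set A := conj_set g (standard_parabolic [set t]).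

Lemma conj_parabolic_vertex g :
  complex_vertex (parabolic_complex G) (conj_parabolic g).
Proof.
split; [exact: finite_set1 | by eexists | move=> _ -> | by move=> x y -> ->].
split.
  exists g, [set t]%SET; split=> //; last exact: finite_type1.
  split; first by apply/set0Pn; exists t; rewrite inE.
  move=> [T1 [T2 [[TU TI T1n T2n] _]]].
  have tT (T' : {set G}) : T' \subset [set t]%SET -> T' != finset.set0 -> t \in T'.
    move=> /fintype.subsetP T't /set0Pn[u uT]; have := T't _ uT.
    by rewrite inE => /eqP <-.
  have : t \in (T1 :&: T2)%SET.
    by rewrite inE !tT // -TU; [exact: finset.subsetUr | exact: finset.subsetUl].
  by rewrite TI inE.
move=> E; have : conj_parabolic g (g * artin_gen s * g^-1).
  by rewrite E.
move=> [a Ta /mulIg/mulgI as_]; subst a.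
by have := gen_notin_parabolic R Ta; rewrite inE (negbTE s_neq_t).
Qed.

(** With [g] the translation along one unfixed block, the geodesic from the base vertex to its image
    under [g ^+ N] consists of [N] blocks, while a path of length [n] in the complex covers it by
    [2 * n + 1] pieces. *)
Lemma far_parabolics : exists g : A, forall N n,
  edge_path (parabolic_complex G) n (conj_parabolic 1) (conj_parabolic (g ^+ N)) ->
  N <= n.*2.+1.
Proof.
have [ws wss [ws0 wsN]] := unfixed_block R s_neq_t st_nonadj G_irr.
pose g := advance s t 1 ws; exists g => N n path.
have [l [ls lE lA]] : exists l, [/\ all (fun w => w != s) l,
    block s t 1 l = flatten (mkseq (fun i => block s t (g ^+ i) ws) N) &
    advance s t 1 l = g ^+ N].
  elim: N {path} => [|N [l [ls lE lA]]]; first by exists [::].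
  exists (l ++ ws); rewrite all_cat ls wss; split=> //.
    by rewrite block_cat lE lA mkseqS flatten_rcons.
  by rewrite /advance foldl_cat -!/(advance _ _ _ _) lA -{1}[g ^+ N]mulg1 advance_mul expgSr.
have fixed h : fixed_by (conj_parabolic h) (coset_vertex H true h).
  move=> _ [a Ta <-]; apply/(translate_fix sH); rewrite -mulgA mulgVK mulKg.
  apply: standard_parabolic_sub Ta; apply/fintype.subsetP => u.
  by rewrite !inE => /eqP->; rewrite eq_sym.
have irr1 : irreducible_finite_type_parabolic (conj_parabolic 1).
  by case: (conj_parabolic_vertex 1) => _ _ /(_ _ erefl)[].
have [p rp [lp cp]] := edge_path_covers path irr1 (connected_coset _ _)
  (connected_coset _ _) (fixed 1) (fixed (g ^+ N)) (covers0 _).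
have pE : p = block s t 1 l.
  apply: (reduced_unique adj_sym acyclic rp); first exact: block_reduced.
  by rewrite lp last_block lA.
move: cp; rewrite pE lE -[flatten _]cats0 add0n => /covered_blocks; apply.
  by move=> i; case: (ws) ws0.
by move=> i r; apply: wsN.
Qed.

Lemma diameter_infinite : diameter (parabolic_complex G) R = +oo%E.
Proof.
have [g far] := far_parabolics; apply/eqyP => M M0.
have [K MK] : exists K : nat, (M <= K%:R)%R.
  by exists (Num.bound M); rewrite ltW // archi_boundP // ltW.
(* [2 * K + 2 <= 2 * n + 1] forces [K < n] for every edge path; if there is none, the infimum is
   infinite. *)
pose P := conj_parabolic (g ^+ K.*2.+2).
apply: (@le_trans _ _ (complex_dist (parabolic_complex G) R (conj_parabolic 1) P)).
  apply: le_ereal_inf_tmp => _ [n path <-]; rewrite lee_fin (le_trans MK) // ler_nat.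
  by have := far _ _ path; rewrite ltnS ltn_double; exact: ltnW.
apply: ereal_sup_ubound; exists (conj_parabolic 1); first exact: conj_parabolic_vertex.
by exists P => //; exact: conj_parabolic_vertex.
Qed.

End Distances.

Theorem theorem5p3 (R : realType) (G : labeled_graph) :
  irreducible [set: G]%SET -> FC_type G -> ~ is_join G -> 2 <= #|G| ->
  diameter (parabolic_complex G) R = +oo%E.
Proof.
move=> irr _ nj G2.
have [s _] : exists s : G, s \in G by apply/card_gt0P; exact: ltn_trans G2.
have [t st] : exists t : G, s != t /\ ~~ adjacent_vertices s t.
  (* If [s] were adjacent to all other vertices, [[set s]] and its complement, nonempty by
     [2 <= #|G|], would exhibit a join. *)
  apply: contra_notP nj => nt; exists [set s]%SET, (~: [set s])%SET; split.
    split; [exact: finset.setUCr | exact: finset.setICr | |].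
      by apply/set0Pn; exists s; rewrite inE.
    by rewrite -card_gt0 cardsC1 -subn1 subn_gt0.
  move=> u w; rewrite !inE => /eqP-> ws; apply: contrapT => sw; apply: nt.
  by exists w; rewrite eq_sym ws; split=> //; apply/negP.
by case: st => st sta; exact: (diameter_infinite _ st sta irr).
Qed.
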